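(* Let $\underline{\mathcal D}$ be the image in $\underline{\boldsymbol X}=\boldsymbol X/\boldsymbol\Gamma$ of the surface $\mathcal D=\{[x,y,z]\in\boldsymbol X : x+y\in\mathbb Z\}$. Then $\underline{\mathcal D}$ is a section of the flow $\Phi_\lambda$ (acting on $\underline{\boldsymbol X}$) with constant return time equal to $1$, and the first return map of the flow to this section coincides with the niltranslation $\underline{T_\sigma}$ on $\underline{\mathcal D}$. In addition, the map $T_\Sigma$ on $\Sigma$ is measurably conjugate to the niltranslation $\underline{T_\sigma}$ on $\underline{\mathcal D}$, which is also self-induced.
   Context: Heisenberg group. $\boldsymbol X=\mathbb H_3(\mathbb R)$ is the set of $[x,y,z]=\begin{pmatrix}1&x&z\\0&1&y\\0&0&1\end{pmatrix}$, with $[x,y,z]\bullet[x',y',z']=[x+x',y+y',z+z'+xy']$. $\boldsymbol\Gamma$ is the subgroup of integer matrices and $\underline{\boldsymbol X}=\boldsymbol X/\boldsymbol\Gamma$ is the space of cosets $\boldsymbol x\bullet\boldsymbol\Gamma$. Let $\boldsymbol n_a=[1,0,0]$, $\boldsymbol n_b=[0,1,0]$. For $(\alpha,\beta,\gamma)\in\mathbb R^3$ the flow $\Phi^t_{\alpha,\beta,\gamma}$ is left multiplication by $[\alpha t,\beta t,\gamma t+\frac{\alpha\beta}{2}t^2]$, $t\in\mathbb R$; it acts on $\boldsymbol X$ and on $\underline{\boldsymbol X}$. Automorphism. $\sigma$ is an automorphism of the free group $\mathbb F_2$ on $\{a,b\}$. It induces the automorphism $\mathfrak S_\sigma$ of $\boldsymbol\Gamma$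 with $\mathfrak S_\sigma(\pi(w))=\pi(\sigma(w))$ for $w\in\mathbb F_2$, where $\pi:\mathbb F_2\to\boldsymbol\Gamma$, $\pi(a)=\boldsymbol n_a$, $\pi(b)=\boldsymbol n_b$. Let $M_\sigma=\begin{pmatrix}A&B\\C&D\end{pmatrix}$ be the integer matrix of the action of $\mathfrak S_\sigma$ on the $(x,y)$ coordinates (on column vectors), and let $n_a^{a,b}$, $n_b^{a,b}$ be the $z$-coordinates of $\mathfrak S_\sigma(\boldsymbol n_a)$ and $\mathfrak S_\sigma(\boldsymbol n_b)$. Standing hypotheses. $M_\sigma$ has two real eigenvalues $\lambda,\lambda'$ with $|\lambda\lambda'|=1$ and $|\lambda|>|\lambda'|$. $(\alpha,\beta)$ is an eigenvector for $\lambda$ with $\alpha\ge0$, $\beta\ge0$, $\alpha+\beta=1$. $(\alpha',\beta')$ is an eigenvector for $\lambda'$ with $\alpha'^2+\beta'^2=1$, $\alpha'>0$ and $\beta'<0$. Put $$\gamma=\frac{\alpha}{\lambda-\det M_\sigma}\Big(n_a^{a,b}-\frac{AC}2\Big)+\frac{\beta}{\lambda-\det M_\sigma}\Big(n_b^{a,b}-\frac{BD}2\Big),$$ and let $\gamma'$ be given by the same formula with $(\alpha',\beta',\lambda')$ in place of $(\alpha,\beta,\lambda)$. Let $\Phi_\lambda=\Phi_{\alpha,\beta,\gamma}$ and $\Phi_{\lambda'}=\Phi_{\alpha',\beta',\gamma'}$. Let $\Delta=\alpha\beta'-\alpha'\beta<0$, $t_a=\beta'/\Delta>0$, $t_b=-\alpha'/\Delta>0$,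 $d_a=\sqrt{(t_a\alpha-1)^2+(t_a\beta)^2}$, $d_b=\sqrt{(t_b\alpha)^2+(t_b\beta-1)^2}$. Section $\Sigma$. Let $S=\{\Phi_\lambda^t\circ\Phi_{\lambda'}^s([0,0,0]):(t,s)\in\mathbb R^2\}$. It is the graph $z=Q_\sigma(x,y)$ of a polynomial $Q_\sigma$ of degree $2$. Let $$\Sigma=\Big\{[\alpha's,\beta's,z]: s\in[-d_a,d_b),\ Q_\sigma(\alpha's,\beta's)-\tfrac12\le z<Q_\sigma(\alpha's,\beta's)+\tfrac12\Big\},$$ viewed in $\underline{\boldsymbol X}$. $T_\Sigma:\Sigma\to\Sigma$ is the first return map of the flow $\Phi_\lambda$ on $\underline{\boldsymbol X}$ to $\Sigma$; the measure on $\Sigma$ is $ds\,dz$. Niltranslation. $T_\sigma$ is left multiplication by $\boldsymbol g_\sigma=[\alpha,\beta,\gamma+\frac{\alpha\beta}2]$ and $\underline{T_\sigma}$ is the induced map on $\underline{\boldsymbol X}$; it preserves $\underline{\mathcal D}$, which carries its invariant (Haar) probability measure. Self-induced. A measure-preserving system $(Y,T,\mu)$ is self-induced if there is a measurable $A\subset Y$ with $0<\mu(A)<\mu(Y)$ such that the first return map of $T$ to $A$, with the normalized restriction of $\mu$, is measurably conjugate to $(Y,T,\mu)$ with $\mu$ normalized (conjugacy by a bi-measurable measure-preserving bijection up to null sets). *)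

(* Defs.v *)
From HB Require Import structures.
From mathcomp Require Import all_boot all_order all_algebra generic_quotient.
From mathcomp Require Import all_classical all_reals all_analysis.
From mathcomp Require Import ring.

Set Implicit Arguments.
Unset Strict Implicit.
Unset Printing Implicit Defensive.

Import Order.TTheory GRing.Theory Num.Theory.
Import numFieldNormedType.Exports.

Local Open Scope classical_set_scope.
Local Open Scope ring_scope.

(* A letter is a pair (generator, sign): (true, true) is a, (false, true) is b,
   and sign false denotes the inverse.  A word is stored with its first letter
   at the head of the list; the free group is the set of reduced words, with
   reduced concatenation as product. *)
Notation letter := (bool * bool)%type.

Definition letterV (l : letter) : letter := (l.1, ~~ l.2).

Definition reduced (w : seq letter) : bool :=
  sorted (fun l l' => l' != letterV l) w.

Record F2 : Type := MkF2 { word : seq letter; word_reduced : reduced word }.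

HB.instance Definition _ := [isSub for word].
HB.instance Definition _ := [Choice of F2 by <:].

Definition push (l : letter) (w : seq letter) : seq letter :=
  if w is l' :: w' then (if l' == letterV l then w' else l :: w) else [:: l].

Definition wmul (u v : seq letter) : seq letter := foldr push v u.

Definition winv (u : seq letter) : seq letter := rev (map letterV u).

Lemma letterVK : involutive letterV.
Proof. by case=> g s; rewrite /letterV /= negbK. Qed.

Lemma letterV_neq l : l != letterV l.
Proof. by case: l => g [] /=; rewrite xpair_eqE eqxx. Qed.

Lemma reduced_push l w : reduced w -> reduced (push l w).
Proof.
case: w => //= l' w' rw; case: ifP => [_|/negbT nl]; first exact: path_sorted rw.
by rewrite /= nl.
Qed.

Lemma reduced_wmul u v : reduced v -> reduced (wmul u v).
Proof. by move=> rv; elim: u => //= l u; apply: reduced_push. Qed.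

Lemma reduced_winv u : reduced u -> reduced (winv u).
Proof.
rewrite /winv /reduced rev_sorted sorted_map; apply: sub_sorted => l l' /=.
by apply: contra; rewrite letterVK => /eqP <-.
Qed.

Lemma pushK l w : reduced w -> push l (push (letterV l) w) = w.
Proof.
case: w => [|l' w] /=; first by rewrite eqxx.
rewrite letterVK; case: (eqVneq l' l) => [->|nl] /=; last by rewrite eqxx.
by case: w => //= l'' w /andP[/negbTE ->].
Qed.

Lemma wmul_push l u v : reduced u -> reduced v ->
  wmul (push l u) v = push l (wmul u v).
Proof.
case: u => //= l' u ru rv; case: eqP => //= ->.
by rewrite pushK // reduced_wmul.
Qed.

Lemma wmulA u v w : reduced v -> reduced w ->
  wmul u (wmul v w) = wmul (wmul u v) w.
Proof.
move=> rv rw; elim: u => //= l u ->.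
by rewrite wmul_push // reduced_wmul.
Qed.

Lemma wmulw0 u : reduced u -> wmul u [::] = u.
Proof.
elim: u => //= l u IHu ru; rewrite IHu; last exact: path_sorted ru.
by case: u ru {IHu} => //= l' u /andP[/negbTE ->].
Qed.

Lemma wmul_cat u1 u2 v : wmul (u1 ++ u2) v = wmul u1 (wmul u2 v).
Proof. exact: foldr_cat. Qed.

Lemma wmulwV u v : reduced v -> wmul u (wmul (winv u) v) = v.
Proof.
move=> rv; elim: u v rv => //= l u IHu v rv.
rewrite /winv /= rev_cons -cats1 wmul_cat -/(winv u) IHu ?reduced_push //=.
exact: pushK.
Qed.

Lemma winvK : involutive winv.
Proof.
by move=> u; rewrite /winv map_rev revK -map_comp map_id_in // => l _; apply: letterVK.
Qed.

Definition F2_one : F2 := @MkF2 [::] isT.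
Definition F2_mul (u v : F2) : F2 :=
  MkF2 (reduced_wmul (word u) (word_reduced v)).
Definition F2_inv (u : F2) : F2 := MkF2 (reduced_winv (word_reduced u)).

Lemma F2_mulA : associative F2_mul.
Proof. by move=> u v w; apply/val_inj/wmulA; apply: word_reduced. Qed.
Lemma F2_mul1 : left_id F2_one F2_mul.
Proof. by move=> u; apply/val_inj. Qed.
Lemma F2_mulr1 : right_id F2_one F2_mul.
Proof. by move=> u; apply/val_inj/wmulw0/word_reduced. Qed.
Lemma F2_mulV : right_inverse F2_one F2_inv F2_mul.
Proof.
move=> u; apply/val_inj => /=.
by rewrite -[X in wmul _ X](wmulw0 (reduced_winv (word_reduced u))) wmulwV.
Qed.
Lemma F2_mulVl : left_inverse F2_one F2_inv F2_mul.
Proof.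
move=> u; rewrite -[X in F2_mul _ X](_ : F2_inv (F2_inv u) = u) ?F2_mulV //.
by apply/val_inj; apply: winvK.
Qed.

HB.instance Definition _ :=
  isGroup.Build F2 F2_mulA F2_mul1 F2_mulr1 F2_mulVl F2_mulV.

Definition F2a : F2 := @MkF2 [:: (true, true)] isT.
Definition F2b : F2 := @MkF2 [:: (false, true)] isT.

(* [Heis x y z] is the unipotent matrix (1 x z; 0 1 y; 0 0 1). *)
Record heis (K : Type) : Type := Heis { hx : K; hy : K; hz : K }.
Arguments Heis {K}.

Definition heis_triple (K : Type) (g : heis K) : K * K * K := (hx g, hy g, hz g).
Definition triple_heis (K : Type) (p : K * K * K) : heis K :=
  Heis p.1.1 p.1.2 p.2.

Lemma heis_tripleK K : cancel (@heis_triple K) (@triple_heis K).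
Proof. by case. Qed.

HB.instance Definition _ (K : choiceType) :=
  Choice.copy (heis K) (can_type (@heis_tripleK K)).

Section HeisGroup.
Variable K : comNzRingType.
Implicit Types g h : heis K.

Definition heis_mul g h : heis K :=
  Heis (hx g + hx h) (hy g + hy h) (hz g + hz h + hx g * hy h).
Definition heis_one : heis K := Heis 0 0 0.
Definition heis_inv g : heis K :=
  Heis (- hx g) (- hy g) (- hz g + hx g * hy g).

Lemma heis_mulA : associative heis_mul.
Proof. by case=> ? ? ? [? ? ?] [? ? ?]; congr Heis => /=; ring. Qed.
Lemma heis_mul1 : left_id heis_one heis_mul.
Proof. by case=> ? ? ?; congr Heis => /=; ring. Qed.
Lemma heis_mulr1 : right_id heis_one heis_mul.
Proof. by case=> ? ? ?; congr Heis => /=; ring. Qed.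
Lemma heis_mulVl : left_inverse heis_one heis_inv heis_mul.
Proof. by case=> ? ? ?; congr Heis => /=; ring. Qed.
Lemma heis_mulV : right_inverse heis_one heis_inv heis_mul.
Proof. by case=> ? ? ?; congr Heis => /=; ring. Qed.

HB.instance Definition _ :=
  isGroup.Build (heis K) heis_mulA heis_mul1 heis_mulr1 heis_mulVl heis_mulV.

End HeisGroup.

(* The lattice Gamma is [heis int], embedded in [heis R] by [heis_intr]. *)
Notation Gamma := (heis int).

Definition heis_intr (R : pzRingType) (h : Gamma) : heis R :=
  Heis (hx h)%:~R (hy h)%:~R (hz h)%:~R.

Definition n_a : Gamma := Heis 1 0 0.
Definition n_b : Gamma := Heis 0 1 0.

Definition letter_Gamma (l : letter) : Gamma :=
  let n := if l.1 then n_a else n_b in if l.2 then n else (n^-1)%g.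

Definition F2_Gamma (w : F2) : Gamma := (\prod_(l <- word w) letter_Gamma l)%g.

Lemma F2_Gamma_mul : {morph F2_Gamma : u v / (u * v)%g >-> (u * v)%g}.
Proof.
have pushE l w : (\prod_(m <- push l w) letter_Gamma m =
    letter_Gamma l * \prod_(m <- w) letter_Gamma m)%g.
  case: w => [|l' w] /=; first by rewrite big_seq1 big_nil mulg1.
  case: eqP => [->|_]; rewrite !big_cons // mulgA.
  by case: l => [g []]; rewrite /letter_Gamma /= ?mulgV ?mulVg mul1g.
move=> [u ru] [v rv]; rewrite /F2_Gamma /=.
by elim: u {ru} => [|l u IHu] /=; rewrite ?big_nil ?mul1g // pushE IHu big_cons mulgA.
Qed.

HB.instance Definition _ := isMultiplicative.Build F2 Gamma F2_Gamma F2_Gamma_mul.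

Lemma F2_Gamma_a : F2_Gamma F2a = n_a.
Proof. by rewrite /F2_Gamma big_seq1. Qed.
Lemma F2_Gamma_b : F2_Gamma F2b = n_b.
Proof. by rewrite /F2_Gamma big_seq1. Qed.

Definition vec2 (K : Type) (x y : K) : 'cV[K]_2 :=
  \col_i (if i == 0 then x else y).

Definition heis_xy (K : Type) (g : heis K) : 'cV[K]_2 := vec2 (hx g) (hy g).

Section Nilmanifold.
Variable R : realType.
Implicit Types g h : heis R.

Lemma heis_intr_mul (u v : Gamma) :
  heis_intr R (u * v)%g = (heis_intr R u * heis_intr R v)%g.
Proof. by congr Heis; rewrite /= ?rmorphD ?rmorphM. Qed.

Lemma heis_intr1 : heis_intr R 1%g = 1%g.
Proof. by []. Qed.

Definition same_coset g h : bool :=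
  `[< exists u : Gamma, h = (g * heis_intr R u)%g >].

Lemma same_coset_refl : reflexive same_coset.
Proof. by move=> g; apply/asboolP; exists 1%g; rewrite heis_intr1 mulg1. Qed.

Lemma same_coset_sym : symmetric same_coset.
Proof.
suff imp g h : same_coset g h -> same_coset h g by move=> g h; apply/idP/idP; exact: imp.
move=> /asboolP[u ->]; apply/asboolP; exists (u^-1)%g.
by rewrite -mulgA -heis_intr_mul mulgV heis_intr1 mulg1.
Qed.

Lemma same_coset_trans : transitive same_coset.
Proof.
move=> h g k /asboolP[u ->] /asboolP[v ->]; apply/asboolP.
by exists (u * v)%g; rewrite heis_intr_mul mulgA.
Qed.

Canonical same_coset_equiv :=
  EquivRel same_coset same_coset_refl same_coset_sym same_coset_trans.

Definition nilm : Type := {eq_quot same_coset_equiv}%qT.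

HB.instance Definition _ := Choice.on nilm.
HB.instance Definition _ := EqQuotient.on nilm.

Definition nproj g : nilm := (\pi_nilm g)%qT.

Lemma nprojP g h : nproj g = nproj h <-> exists u : Gamma, h = (g * heis_intr R u)%g.
Proof.
by split=> [/eqquotP/asboolP|e] //; apply/eqquotP/asboolP.
Qed.

HB.instance Definition _ := isPointed.Build nilm (nproj 1%g).

(* Borel sets of the quotient: a set is measurable when its inverse image in R^3
   is Borel.  As Gamma is countable and has a Borel fundamental domain, this is
   also the sigma-algebra generated by the quotient topology. *)
Definition nilm_measurable : set (set nilm) :=
  image_set_system setT (fun p : R * R * R => nproj (triple_heis p)) measurable.

Let nilm_salg : sigma_algebra setT nilm_measurable.
Proof. exact/sigma_algebra_image/sigma_algebra_measurable. Qed.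

Let nilm_measurableC A : nilm_measurable A -> nilm_measurable (~` A).
Proof. by move=> mA; rewrite -setTD; case: nilm_salg => _ + _; apply. Qed.

HB.instance Definition _ := @isMeasurable.Build default_measure_display nilm
  nilm_measurable (let: And3 p _ _ := nilm_salg in p) nilm_measurableC
  (let: And3 _ _ p := nilm_salg in p).

(* Well defined on cosets: see [nactE]. *)
Definition nact g (p : nilm) : nilm := nproj (g * repr p)%g.

Lemma nactE g h : nact g (nproj h) = nproj (g * h)%g.
Proof.
rewrite /nact; have /nprojP[u {2}->] : nproj (repr (nproj h)) = nproj h.
  exact: reprK.
by apply/nprojP; exists u; rewrite mulgA.
Qed.

Definition flow_elt (al be ga t : R) : heis R :=
  Heis (al * t) (be * t) (ga * t + al * be / 2 * t ^+ 2).

Definition flow (al be ga t : R) (p : nilm) : nilm := nact (flow_elt al be ga t) p.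

Definition niltranslation (al be ga : R) (p : nilm) : nilm :=
  nact (Heis al be (ga + al * be / 2)) p.

Definition surfD : set (heis R) := [set g | hx g + hy g \is a Num.int].

Definition nilD : set nilm := nproj @` surfD.

(* [surfD] is a closed subgroup of the Heisenberg group containing Gamma, and
   [nilD] is its homogeneous space: the Haar probability measure of [nilD] is the
   one that is invariant under left translation by [surfD]. *)
Definition is_haar_nilD (mu : probability nilm R) : Prop :=
  mu nilD = 1%E /\
  forall g, surfD g -> forall B, measurable B -> mu (nact g @^-1` B) = mu B.

Definition orbit_surface (al be ga al' be' ga' : R) : set (heis R) :=
  [set g | exists t s : R, g =
    (flow_elt al be ga t * (flow_elt al' be' ga' s * Heis 0 0 0))%g].

(* The coordinates of [p] are (s, z). *)
Definition Sigma_dom (al' be' da db : R) (Q : R -> R -> R) : set (R * R) :=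
  [set p | - da <= p.1 < db /\
    Q (al' * p.1) (be' * p.1) - 1 / 2 <= p.2 < Q (al' * p.1) (be' * p.1) + 1 / 2].

Definition Sigma_param (al' be' : R) (p : R * R) : nilm :=
  nproj (Heis (al' * p.1) (be' * p.1) p.2).

Definition Sigma (al' be' da db : R) (Q : R -> R -> R) : set nilm :=
  Sigma_param al' be' @` Sigma_dom al' be' da db Q.

(* ds dz, transported to [Sigma] by its parametrization *)
Definition Sigma_measure (al' be' da db : R) (Q : R -> R -> R)
    (B : set nilm) : \bar R :=
  (lebesgue_measure \x lebesgue_measure)%E
    (Sigma_dom al' be' da db Q `&` Sigma_param al' be' @^-1` B).

End Nilmanifold.

Arguments nilm : clear implicits.
Arguments surfD : clear implicits.
Arguments nilD : clear implicits.

Section Flows.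
Variables (R : realType) (T : Type) (Phi : R -> T -> T) (S : set T).

Definition is_return_time (x : T) (t : R) : Prop :=
  [/\ 0 < t, S (Phi t x) & forall s, 0 < s < t -> ~ S (Phi s x)].

Definition return_time (x : T) : R := xget 0 [set t | is_return_time x t].

(* junk value [Phi 0 x] when there is no first return *)
Definition return_map (x : T) : T := Phi (return_time x) x.

End Flows.

(* A global section: the condition bears on every point of the space, so that
   every orbit meets [S], and not only on the points of [S]. *)
Definition is_section d (R : realType) (T : measurableType d)
    (Phi : R -> T -> T) (S : set T) : Prop :=
  measurable S /\ forall x, exists t, is_return_time Phi S x t.

Section Induced.
Variables (T : Type) (f : T -> T) (A : set T).

Definition is_return_index (x : T) (n : nat) : Prop :=
  [/\ (0 < n)%N, A (iter n f x) &
      forall m, (0 < m < n)%N -> ~ A (iter m f x)].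

(* junk value [x] when [x] never returns to [A] *)
Definition induced_map (x : T) : T :=
  iter (xget 0%N [set n | is_return_index x n]) f x.

End Induced.

(* A system is given by a carrier [Y] inside a measurable type, a map of the
   ambient type and a measure; only their restrictions to [Y] matter. *)

Definition normalized (R : realType) (T : Type) (mu : set T -> \bar R)
    (Y B : set T) : \bar R :=
  (mu (Y `&` B) * ((fine (mu Y))^-1)%:E)%E.

Record is_mp_system (R : realType) d (T : measurableType d)
    (mu : set T -> \bar R) (Y : set T) (f : T -> T) : Prop := {
  mps_measurable : measurable Y;
  mps_pos : (0 < mu Y < +oo)%E;
  mps_stable : forall x, Y x -> Y (f x);
  mps_measurable_fun : measurable_fun Y f;
  mps_preserved : forall B, measurable B ->
    mu (Y `&` f @^-1` B) = mu (Y `&` B) }.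

Record conjugacy (R : realType) d1 (T1 : measurableType d1)
    d2 (T2 : measurableType d2)
    (mu1 : set T1 -> \bar R) (Y1 : set T1) (f1 : T1 -> T1)
    (mu2 : set T2 -> \bar R) (Y2 : set T2) (f2 : T2 -> T2)
    (X1 : set T1) (X2 : set T2) (h : T1 -> T2) : Prop := {
  conj_measurable1 : measurable X1;
  conj_measurable2 : measurable X2;
  conj_sub1 : X1 `<=` Y1;
  conj_sub2 : X2 `<=` Y2;
  conj_null1 : mu1 (Y1 `\` X1) = 0%E;
  conj_null2 : mu2 (Y2 `\` X2) = 0%E;
  conj_stable : forall x, X1 x -> X1 (f1 x);
  conj_bij : set_bij X1 X2 h;
  conj_measurable_fun : measurable_fun X1 h;
  conj_measurable_image : forall B, measurable B -> measurable (h @` (X1 `&` B));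
  conj_preserved : forall B, measurable B ->
    normalized mu1 Y1 (X1 `&` h @^-1` B) = normalized mu2 Y2 (X2 `&` B);
  conj_commute : forall x, X1 x -> h (f1 x) = f2 (h x) }.

Definition measurably_conjugate (R : realType) d1 (T1 : measurableType d1)
    d2 (T2 : measurableType d2)
    (mu1 : set T1 -> \bar R) (Y1 : set T1) (f1 : T1 -> T1)
    (mu2 : set T2 -> \bar R) (Y2 : set T2) (f2 : T2 -> T2) : Prop :=
  exists X1 X2 h, conjugacy mu1 Y1 f1 mu2 Y2 f2 X1 X2 h.

Definition self_induced (R : realType) d (T : measurableType d)
    (mu : set T -> \bar R) (Y : set T) (f : T -> T) : Prop :=
  is_mp_system mu Y f /\
  exists A : set T, [/\ measurable A, A `<=` Y, (0 < mu A < mu Y)%E &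
    measurably_conjugate mu A (induced_map f A) mu Y f].

(* [na], [nb] are the z-coordinates of the images of the generators.  In the
   coordinates (x, y, z - xy/2) of the Lie algebra the automorphism is linear, and
   (al, be, gamma_coord) is its eigenvector for lam when (al, be) is one of M. *)
Definition gamma_coord (R : realType) (M : 'M[int]_2) (na nb : int)
    (al be lam : R) : R :=
  al / (lam - (\det M)%:~R) * (na%:~R - (M 0 0 * M 1 0)%:~R / 2) +
  be / (lam - (\det M)%:~R) * (nb%:~R - (M 0 1 * M 1 1)%:~R / 2).

(* Main.v *)
From HB Require Import structures.
Require Import Defs.
From mathcomp Require Import all_boot all_order all_algebra.
From mathcomp Require Import all_classical all_reals all_analysis.
From mathcomp Require Import measurable_realfun ring lra.

Set Implicit Arguments.
Unset Strict Implicit.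
Unset Printing Implicit Defensive.

Import Order.TTheory GRing.Theory Num.Theory.

Local Open Scope classical_set_scope.
Local Open Scope ring_scope.

(** Since al + be = 1, the flow increases x + y at unit speed, so D = {x + y
    integer} is a section with return time 1, and the flow at time 1 is the
    niltranslation T.

    Every point of D is the class of [x, -x, z] with x in [-be, al) and z modulo
    1.  In these coordinates T is the exchange x |-> x + al or x |-> x - be of
    two intervals (a rotation), together with a shift of the vertical circle, and
    the Haar probability is dx dz ([haar_nilDE], by averaging and Fubini).

    Both conjugacies come from one construction, the transfer of D.  Take a
    bijection nS of the nilmanifold with nS (Phi t p) = Phi (l t) (nS p), l > 0,
    and let G p = Phi (th * x) (nS p), where x is the coordinate of p in D.  If
    p is in D, the orbit of G p can meet G(D) only in the points
    G (Phi j p), j an integer, and reaches that point at the time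
    F j = l j + th (x (Phi j p) - x p).  The increments of F are l + th al or
    l - th be; when both are positive, F is increasing, so F 1 is the first
    return time of G p to G(D) and G conjugates T to the first return map
    ([transfer_return_time], [transfer_niltranslation]).  Moreover G maps
    vertical circles isometrically to vertical circles and is linear in x, so it
    multiplies the measure by a constant.

    - With nS the identity and th = (al' + be') / |Delta|, the plane x + y = 0 is
      slid to the plane of direction (al', be') and G(D) is Sigma
      ([Sigma_transfer]): this is the conjugacy of T and T_Sigma.

    - The automorphism of the lattice extends to the Heisenberg group by an
      explicit formula ([heis_aut]) and, (al, be, ga) being an eigenvector in the
      Lie algebra, multiplies the time of the flow by lam.  Let nS be its square,
      so that l = lam ^ 2 > 0.  With the suitable th, the set G(D) is the part of
      D over lam' ^ 2 [-be, al), a proper subset of D of measure lam' ^ 2, on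
      which the induced map of T is therefore conjugate to T
      ([niltranslation_self_induced]). *)

(** * Lebesgue integrals under affine maps and of periodic functions *)

Section LebesgueChange.
Variable R : realType.
Local Open Scope ereal_scope.
Local Notation leb := (@lebesgue_measure R).

Section Affine.
Variables (c b : R).
Hypothesis c0 : (0 < c)%R.

Let aff : measurableTypeR R -> measurableTypeR R := fun x => (c * x + b)%R.

Let measurable_aff : measurable_fun setT aff.
Proof. by apply: measurable_funD => //; exact: measurable_funM. Qed.

(** The image of Lebesgue measure under [aff], rescaled by [c]: it agrees with
    Lebesgue measure on half-open intervals, hence everywhere. *)
Let image_leb : {measure set (measurableTypeR R) -> \bar R} :=
  mscale (NngNum (ltW c0))
    (measure_function_pushforward__canonical__measure_function_Measure
       leb measurable_aff).

Lemma affine_preimage_itv (u v : R) :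
  (fun x : R => c * x + b)%R @^-1` `[(c * u + b)%R, (c * v + b)%R[ = `[u, v[%classic.
Proof.
apply/seteqP; split=> x /=; rewrite !in_itv /=;
  by rewrite lerD2r ltrD2r ler_pM2l // ltr_pM2l.
Qed.

Lemma lebesgue_measure_affine (A : set R) : measurable A ->
  leb A = c%:E * leb ((fun x => c * x + b)%R @^-1` A).
Proof.
move=> mA; transitivity (image_leb A); last by [].
apply: lebesgue_measure_unique => // _ [[u v]] _ <-.
rewrite /image_leb /mscale /pushforward /=.
rewrite [X in _ = _ * leb X](_ : _ =
    `](c^-1 * (u - b))%R, (c^-1 * (v - b))%R]%classic); last first.
  apply/seteqP; split=> x /=; rewrite !in_itv /= /aff;
  by rewrite ltr_pdivrMl // ler_pdivlMl // ltrBlDr lerBrDr.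
rewrite !lebesgue_measure_itv /= !lte_fin ltr_pM2l ?invr_gt0 // ltrD2r.
case: ifP => _; last by rewrite mule0.
by rewrite -!EFinB -EFinM; congr EFin; field; rewrite gt_eqF.
Qed.

Lemma ge0_integral_affine (D : set R) (f : R -> \bar R) :
  measurable D -> measurable_fun D f -> (forall x, 0 <= f x) ->
  \int[leb]_(x in D) f x =
  c%:E * \int[leb]_(x in (fun x => c * x + b)%R @^-1` D) f (c * x + b)%R.
Proof.
move=> mD mf f0.
rewrite (eq_measure_integral image_leb) /=; last first.
  by move=> A mA _; exact: lebesgue_measure_affine.
rewrite /image_leb ge0_integral_mscale //; congr (_ * _).
exact: (ge0_integral_pushforward measurable_aff leb mD mf (fun x _ => f0 x)).
Qed.

End Affine.

Lemma ge0_integral_shift (b u v : R) (f : R -> \bar R) :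
  measurable_fun setT f -> (forall x, 0 <= f x) ->
  \int[leb]_(x in `[(u + b)%R, (v + b)%R[) f x = \int[leb]_(x in `[u, v[) f (x + b)%R.
Proof.
move=> mf f0; rewrite (@ge0_integral_affine 1 b) //; last exact: measurable_funTS.
rewrite mul1e.
have -> : `[(u + b)%R, (v + b)%R[%classic = `[(1 * u + b)%R, (1 * v + b)%R[%classic :> set R.
  by rewrite !mul1r.
rewrite affine_preimage_itv //.
by apply: eq_integral => x _; rewrite mul1r.
Qed.

Lemma ge0_integral_scale (c u v : R) (f : R -> \bar R) : (0 < c)%R ->
  measurable_fun setT f -> (forall x, 0 <= f x) ->
  \int[leb]_(x in `[(c * u)%R, (c * v)%R[) f x =
  c%:E * \int[leb]_(x in `[u, v[) f (c * x)%R.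
Proof.
move=> c0 mf f0; rewrite (@ge0_integral_affine c 0) //; last exact: measurable_funTS.
have -> : `[(c * u)%R, (c * v)%R[%classic = `[(c * u + 0)%R, (c * v + 0)%R[%classic :> set R.
  by rewrite !addr0.
rewrite affine_preimage_itv //; congr (_ * _).
by apply: eq_integral => x _; rewrite addr0.
Qed.

Lemma ge0_integral_itv_split (a b c : R) (f : R -> \bar R) : (a <= b <= c)%R ->
  measurable_fun setT f -> (forall x, 0 <= f x) ->
  \int[leb]_(x in `[a, c[) f x =
  \int[leb]_(x in `[a, b[) f x + \int[leb]_(x in `[b, c[) f x.
Proof.
move=> /andP[ab bc] mf f0.
have -> : `[a, c[%classic = `[a, b[%classic `|` `[b, c[%classic :> set R.
  apply/seteqP; split=> x /=; rewrite !in_itv /=.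
    by case: (ltP x b) => xb /andP[-> ?]; [left|right].
  by move=> [|] /andP[h1 h2]; apply/andP; split=> //;
     [exact: lt_le_trans h2 bc|exact: le_trans ab h1].
rewrite ge0_integral_setU //; first exact: measurable_funTS.
rewrite disj_set2E; apply/eqP/seteqP; split=> x //= [].
by rewrite !in_itv /= => /andP[_ h] /andP[]; rewrite leNgt h.
Qed.

(** With n the integer part of a, the part of [a, a + 1) beyond n + 1 is moved
    back by 1, which completes [a, n + 1) to the full period [n, n + 1). *)
Lemma ge0_integral_periodic (a : R) (f : R -> \bar R) :
  measurable_fun setT f -> (forall x, 0 <= f x) -> (forall x, f (x + 1)%R = f x) ->
  \int[leb]_(x in `[a, (a + 1)%R[) f x = \int[leb]_(x in `[0%R, 1%R[) f x.
Proof.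
move=> mf f0 fS.
have fn (n : nat) x : f (x + n%:R)%R = f x.
  by elim: n x => [|n IH] x; rewrite ?addr0 // -natr1 addrA fS.
have fz (z : int) x : f (x + z%:~R)%R = f x.
  case: (intP z) => [|n|n]; rewrite ?addr0 ?fn //.
  by rewrite mulrNz -[LHS](fn n.+1) subrK.
set n := Num.floor a; have /andP[na an] := floor_itv a; rewrite -/n intrD in na an.
rewrite (@ge0_integral_itv_split a (n%:~R + 1)) //; last first.
  by rewrite (ltW an) lerD2r na.
rewrite addeC (@ge0_integral_shift 1 n%:~R a) //.
under eq_integral do rewrite fS.
rewrite -ge0_integral_itv_split ?na ?(ltW an) //.
have -> : `[n%:~R, (n%:~R + 1)%R[%classic =
    `[(0 + n%:~R)%R, (1 + n%:~R)%R[%classic :> set R by rewrite add0r addrC.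
rewrite ge0_integral_shift //.
by apply: eq_integral => x _; rewrite fz.
Qed.

End LebesgueChange.

(** * The flow on the nilmanifold and the coordinate of D *)

Section Nilflow.
Variable R : realType.
Implicit Types (g h : heis R) (p q : nilm R).

Lemma nproj_surj p : exists g, p = nproj g.
Proof. by exists (repr p); rewrite /nproj reprK. Qed.

Lemma nproj_mul_Gamma g (u : Gamma) : nproj (g * heis_intr R u)%g = nproj g.
Proof. by apply/esym/nprojP; exists u. Qed.

(** The vertical line over a point closes up to a circle of length 1. *)
Lemma nproj_vertical (x y z : R) (k : int) :
  nproj (Heis x y (z + k%:~R)) = nproj (Heis x y z).
Proof.
rewrite -(nproj_mul_Gamma (Heis x y z) (Heis 0 0 k)); congr nproj.
by congr Heis => /=; ring.
Qed.

Lemma nilDE g : nilD R (nproj g) <-> hx g + hy g \is a Num.int.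
Proof.
split=> [[h + /nprojP[u ->]]|gint]; last by exists g.
rewrite /surfD /= => hint.
rewrite [X in X \is a _](_ : _ = hx h + hy h + (hx u + hy u)%:~R).
  by rewrite rpredD // intr_int.
by rewrite rmorphD /=; ring.
Qed.

Section Flow.
Variables al be ga : R.
Local Notation Phi := (flow al be ga).

Lemma flow_nproj t g : Phi t (nproj g) = nproj (flow_elt al be ga t * g)%g.
Proof. exact: nactE. Qed.

Lemma flow_eltD s t :
  (flow_elt al be ga s * flow_elt al be ga t)%g = flow_elt al be ga (s + t).
Proof. by congr Heis => /=; field. Qed.

Lemma flowD s t p : Phi s (Phi t p) = Phi (s + t) p.
Proof.
by have [g ->] := nproj_surj p; rewrite !flow_nproj mulgA flow_eltD.
Qed.

Lemma flow0 p : Phi 0 p = p.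
Proof.
have [[x y z] ->] := nproj_surj p; rewrite flow_nproj; congr nproj.
by congr Heis => /=; ring.
Qed.

Hypothesis al_be : al + be = 1.

(** As al + be = 1, the flow increases x + y at unit speed, and x + y is well
    defined modulo 1 on the quotient. *)
Lemma nilD_flow t p : nilD R p -> (nilD R (Phi t p) <-> t \is a Num.int).
Proof.
have [g ->] := nproj_surj p; rewrite flow_nproj !nilDE /= => gint.
rewrite (_ : _ + _ = t + (hx g + hy g)); last first.
  by rewrite -[t in RHS]mul1r -al_be; ring.
by split=> [h|tint]; [rewrite -(addrK (hx g + hy g) t) rpredB|rewrite rpredD].
Qed.

Lemma niltranslationE p : niltranslation al be ga p = Phi 1 p.
Proof. by congr (nact (Heis _ _ _) _); ring. Qed.

Lemma iter_niltranslation n p : iter n (niltranslation al be ga) p = Phi n%:R p.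
Proof.
elim: n => [|n IH] /=; first by rewrite flow0.
by rewrite niltranslationE IH flowD -natr1 addrC.
Qed.

Lemma nilD_niltranslation p : nilD R p -> nilD R (niltranslation al be ga p).
Proof. by move=> Dp; rewrite niltranslationE; apply/nilD_flow. Qed.

Lemma nilD_return_time p : nilD R p -> is_return_time Phi (nilD R) p 1.
Proof.
move=> Dp; split=> // [|s /andP[s0 s1] /(nilD_flow s Dp) /intrP[k sk]].
  exact/nilD_flow.
by move: s0 s1; rewrite sk ltr0z ltrz1; case: k {sk} => [[|k]|k].
Qed.

Lemma nilD_return_exists p : exists t, is_return_time Phi (nilD R) p t.
Proof.
have [g ->] := nproj_surj p; set w := hx g + hy g.
have DE t : nilD R (Phi t (nproj g)) <-> w + t \is a Num.int.
  rewrite flow_nproj nilDE /= (_ : _ + _ = w + t) //.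
  by rewrite -[t in RHS]mul1r -al_be /w; ring.
have /andP[nw wn] := floor_itv w; set n := Num.floor w in nw wn.
exists ((n + 1)%:~R - w); split; first by rewrite subr_gt0.
  by apply/DE; rewrite addrC subrK intr_int.
move=> s /andP[s0]; rewrite ltrBrDl => sn /DE /intrP[k wk].
have := le_lt_trans nw (_ : w < w + s); rewrite ltrDl => /(_ s0).
rewrite wk ltr_int => nk; move: sn; rewrite wk ltr_int ltzD1.
by rewrite leNgt nk.
Qed.

End Flow.

Section FundamentalDomain.
Variables al be : R.
Hypothesis al_be : al + be = 1.

(** Right multiplication by [0, k, 0] moves every point of D to the plane
    x + y = 0, so that (x, z) are coordinates on D; the identifications that
    remain are those of [nproj_vertical] and [nilD_paramD1]. *)
Definition nilD_param (x z : R) : nilm R := nproj (Heis x (- x) z).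

Lemma nilD_nilD_param x z : nilD R (nilD_param x z).
Proof. by apply/nilDE; rewrite /= subrr. Qed.

Lemma nilD_paramD1 x z : nilD_param (x + 1) (z - x) = nilD_param x z.
Proof.
rewrite -[RHS](nproj_mul_Gamma _ (Heis 1 (-1) 0)); congr nproj.
by congr Heis => /=; ring.
Qed.

Lemma nilD_param_int x x' z z' :
  nilD_param x z = nilD_param x' z' -> x' - x \is a Num.int.
Proof. by move=> /nprojP[u [-> _ _]]; rewrite addrC addKr intr_int. Qed.

Lemma nilD_param_inj (x x' z z' : R) : -be <= x < al -> -be <= x' < al ->
  nilD_param x z = nilD_param x' z' -> x = x'.
Proof.
move=> /andP[x0 x1] /andP[x'0 x'1] /nilD_param_int /intrP[k xk].
suff k0 : k = 0 by apply/eqP; rewrite eq_sym -subr_eq0 xk k0.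
have ? := al_be.
have k1 : k < 1 by rewrite -(ltr_int R) -xk; lra.
have k2 : - 1 < k by rewrite -(ltr_int R) -xk mulrNz; lra.
by apply/eqP; rewrite eq_le -!ltzD1 add0r k1 -ltrBlDr sub0r.
Qed.

(** The interval [-be, al) has length 1: it is the fundamental domain of the
    x-circle on which the niltranslation is an exchange of two intervals, and
    which the projection of [Sigma] along the flow covers exactly. *)
Lemma nilD_paramP p : nilD R p ->
  exists x z, -be <= x < al /\ p = nilD_param x z.
Proof.
have [[x y z] ->] := nproj_surj p; rewrite nilDE /= => /intrP[m xym].
have /andP[kx xk] := floor_itv (x + be); set k := Num.floor _ in kx xk.
exists (x - k%:~R), (z + x * (k - m)%:~R); split.
  by have ? := al_be; rewrite rmorphD /= in xk; apply/andP; split; lra.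
rewrite -(nproj_mul_Gamma _ (Heis (- k) (k - m) 0)); congr nproj.
rewrite (_ : y = m%:~R - x); last by rewrite -xym; ring.
by congr Heis => /=; ring.
Qed.

Definition nilD_coord p : R :=
  xget 0 [set x | -be <= x < al /\ exists z, p = nilD_param x z].

Lemma nilD_coordE (x z : R) : -be <= x < al -> nilD_coord (nilD_param x z) = x.
Proof.
move=> xI; rewrite /nilD_coord; case: xgetP => [x' _ [x'I [z']]|/(_ x)[]].
  by move=> /nilD_param_inj -> //.
by split=> //; exists z.
Qed.

End FundamentalDomain.

Section Rotation.
Variables al be ga : R.
Hypotheses (al_be : al + be = 1) (al_ge0 : 0 <= al) (be_ge0 : 0 <= be).

(** On the x-circle the niltranslation is the rotation by al; in [-be, al) the
    point x + al is brought back by 1 = al + be exactly when x >= 0. *)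
Lemma nilD_coord_niltranslation p : nilD R p ->
  let d := nilD_coord al be (niltranslation al be ga p) - nilD_coord al be p in
  d = al \/ d = - be.
Proof.
move=> /(nilD_paramP al_be)[x [z [xI ->]]] /=.
rewrite (nilD_coordE al_be) //; move: (xI) => /andP[x0 x1].
have -> : niltranslation al be ga (nilD_param x z) =
    nproj (Heis (x + al) (be - x) (ga + al * be / 2 + z - al * x)).
  by rewrite /niltranslation nactE; congr nproj; congr Heis => /=; ring.
have [? ?] := (al_ge0, be_ge0).
have be1 : be = 1 - al by rewrite -al_be; ring.
case: (ltP x 0) => x2; [left|right].
  rewrite -(nproj_mul_Gamma _ (Heis 0 (-1) 0)).
  set g := (_ * _)%g; have -> : g = Heis (x + al) (- (x + al)) (hz g).
    by rewrite /g be1; congr Heis => /=; ring.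
  by rewrite -/(nilD_param _ _) (nilD_coordE al_be); [ring|apply/andP; split; lra].
rewrite -(nproj_mul_Gamma _ (Heis (-1) 0 0)).
set g := (_ * _)%g; have -> : g = Heis (x - be) (- (x - be)) (hz g).
  by rewrite /g be1; congr Heis => /=; ring.
by rewrite -/(nilD_param _ _) (nilD_coordE al_be); [ring|apply/andP; split; lra].
Qed.

End Rotation.
End Nilflow.

(** * Borel sets of the nilmanifold and lengths of vertical fibres *)

Ltac measurable_poly :=
  repeat first [ exact: measurable_cst | exact: measurable_id
               | exact: measurable_fst | exact: measurable_snd
               | exact: (measurableT_comp measurable_fst measurable_fst)
               | exact: (measurableT_comp measurable_snd measurable_fst)
               | exact: (measurableT_comp measurable_fst measurable_snd)
               | exact: (measurableT_comp measurable_snd measurable_snd)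
               | apply: measurable_funD | apply: measurable_funB
               | apply: measurable_funN | apply: measurable_funM
               | apply: measurable_funX ].

Section NilMeasurable.
Variable R : realType.

Definition coord_nproj (w : R * R * R) : nilm R := nproj (triple_heis w).

Lemma nilm_measurableP (B : set (nilm R)) :
  measurable B <-> measurable (coord_nproj @^-1` B).
Proof. by rewrite -[X in _ <-> measurable X]setTI. Qed.

Lemma measurable_coord_nproj : measurable_fun setT coord_nproj.
Proof. by move=> _ B /nilm_measurableP mB; rewrite setTI. Qed.

Lemma measurable_nproj d (T : measurableType d) (f g h : T -> R) :
  measurable_fun setT f -> measurable_fun setT g -> measurable_fun setT h ->
  measurable_fun setT (fun t => nproj (Heis (f t) (g t) (h t))).
Proof.
move=> mf mg mh.
apply: (measurableT_comp measurable_coord_nproj (g := fun t => (f t, g t, h t))).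
by apply/measurable_fun_pair => //; exact/measurable_fun_pair.
Qed.

(** The saturation of a Borel set is the countable union of its translates by
    the lattice.  All measurability statements about maps between subsets of the
    nilmanifold reduce to this one, by choosing Borel sets of representatives. *)
Lemma measurable_coord_nproj_image (W : set (R * R * R)) :
  measurable W -> measurable (coord_nproj @` W).
Proof.
move=> mW; apply/nilm_measurableP.
pose tr (u : int * int * int) (w : R * R * R) : R * R * R :=
  (w.1.1 + u.1.1%:~R, w.1.2 + u.1.2%:~R, w.2 + u.2%:~R + w.1.1 * u.1.2%:~R).
have trE u w : coord_nproj (tr u w) = coord_nproj w.
  by rewrite /coord_nproj -[RHS](nproj_mul_Gamma _ (triple_heis u)).
have -> : coord_nproj @^-1` (coord_nproj @` W) = \bigcup_u (tr u @^-1` W).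
  apply/seteqP; split=> [w [w' Ww' /esym/nprojP[u e]]|w [u _ Ww]]; last first.
    by exists (tr u w).
  exists (heis_triple u) => //=; rewrite (_ : tr _ w = w') //.
  by case: w' e {Ww'} => [[x y] z] [-> -> ->].
apply: countable_bigcupT_measurable; first exact: countableP.
move=> u; rewrite -[X in measurable X]setTI.
suff mtr : measurable_fun setT (tr u) by exact: mtr.
by apply/measurable_fun_pair; [apply/measurable_fun_pair|]; measurable_poly.
Qed.

Lemma measurable_nilD : measurable (nilD R).
Proof.
rewrite (_ : nilD R = coord_nproj @` [set w | w.1.1 + w.1.2 = 0]).
  apply: measurable_coord_nproj_image.
  rewrite (_ : [set _ | _] = (fun w : R * R * R => w.1.1 + w.1.2) @^-1` [set 0]) //.
  rewrite -[X in measurable X]setTI.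
  suff mf : measurable_fun setT (fun w : R * R * R => w.1.1 + w.1.2) by exact: mf.
  by measurable_poly.
apply/seteqP; split=> [p|_ [[[x y] z] /= xy0 <-]].
  have [[x y z] ->] := nproj_surj p; rewrite nilDE /= => /intrP[m xym].
  exists (x, y - m%:~R, z - x * m%:~R); first by rewrite /= addrA xym subrr.
  rewrite -[RHS](nproj_mul_Gamma _ (Heis 0 (- m) 0)); congr nproj.
  by congr Heis => /=; ring.
by apply/nilDE; rewrite /= xy0.
Qed.

End NilMeasurable.

Section FiberMeasure.
Variable R : realType.
Local Notation leb := (@lebesgue_measure R).
Implicit Type B : set (nilm R).

Definition fiber_measure B (x y : R) : \bar R :=
  leb [set z | 0 <= z < 1 /\ B (nproj (Heis x y z))].

Lemma fiber_measure_ge0 B x y : (0 <= fiber_measure B x y)%E.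
Proof. exact: measure_ge0. Qed.

Lemma measurable_fiber B x y : measurable B ->
  measurable [set z : measurableTypeR R | B (nproj (Heis x y z))].
Proof.
move=> mB; rewrite -[X in measurable X]setTI.
suff mf : measurable_fun setT (fun z => nproj (Heis x y z)) by exact: mf.
by apply: measurable_nproj; measurable_poly.
Qed.

(** The length of a set on a vertical circle does not depend on where the circle
    is cut, nor on the origin chosen on it. *)
Lemma fiber_measureE B x y (c d : R) : measurable B ->
  leb [set z | c <= z < c + 1 /\ B (nproj (Heis x y (z + d)))] =
  fiber_measure B x y.
Proof.
move=> mB; pose f z : \bar R := (\1_[set z | B (nproj (Heis x y z))] z)%:E.
have mf : measurable_fun setT f.
  by apply/measurable_EFinP; apply: measurable_indic; apply: measurable_fiber.
have f0 z : (0 <= f z)%E by rewrite lee_fin.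
have fS z : f (z + 1) = f z.
  rewrite /f !indicE; congr ((nat_of_bool _)%:R%:E); apply/idP/idP;
    by rewrite !inE /= (nproj_vertical _ _ _ 1).
have E (a b : R) : (\int[leb]_(z in `[a, (a + 1)%R[) f (z + b)%R)%E =
    leb [set z | a <= z < a + 1 /\ B (nproj (Heis x y (z + b)))].
  have -> : (fun z => f (z + b)) =
      EFin \o \1_[set z | B (nproj (Heis x y (z + b)))].
    by apply/funext => z; rewrite /f /= !indicE.
  have mBb : measurable [set z : measurableTypeR R | B (nproj (Heis x y (z + b)))].
    rewrite -[X in measurable X]setTI.
    suff mh : measurable_fun setT (fun z : R => nproj (Heis x y (z + b))) by exact: mh.
    by apply: measurable_nproj; measurable_poly.
  rewrite integral_indic //; congr leb; apply/seteqP; split=> z /=;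
    by rewrite in_itv /= => -[].
have P a b : leb [set z | a <= z < a + 1 /\ B (nproj (Heis x y (z + b)))] =
    (\int[leb]_(z in `[0%R, 1%R[) f z)%E.
  by rewrite -E -ge0_integral_shift // [(a + 1 + b)%R]addrAC ge0_integral_periodic.
rewrite P -(P 0 0) /fiber_measure add0r; congr leb.
by apply/seteqP; split=> z /=; rewrite addr0.
Qed.

End FiberMeasure.

(** * The Haar probability of D in coordinates *)

Section NilDFiber.
Variable R : realType.
Local Notation leb := (@lebesgue_measure R).
Local Notation R' := (measurableTypeR R).
Variable B : set (nilm R).
Hypothesis mB : measurable B.

Definition nilD_fiber (x : R) : \bar R := fiber_measure B x (- x).

Lemma nilD_fiberE (x c d : R) :
  leb [set z | c <= z < c + 1 /\ B (nilD_param x (z + d))] = nilD_fiber x.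
Proof. exact: fiber_measureE. Qed.

Lemma measurable_unit_itv d (T : measurableType d) (f : T -> R) (c : R) :
  measurable_fun setT f -> measurable [set t | c <= f t < c + 1].
Proof.
move=> mf; rewrite -[X in measurable X]setTI.
rewrite (_ : [set t | c <= f t < c + 1] = f @^-1` `[c, c + 1[%classic).
  exact: mf.
by apply/seteqP; split=> t /=; rewrite in_itv.
Qed.

Lemma measurable_nilD_fiber : measurable_fun setT nilD_fiber.
Proof.
pose E : set (R' * R') :=
  [set w : R' * R' | 0 <= w.2 < 0 + 1] `&`
  (fun w : R' * R' => nilD_param w.1 w.2) @^-1` B.
have mE : measurable E.
  apply: measurableI; first by apply: measurable_unit_itv; exact: measurable_snd.
  rewrite -[X in measurable X]setTI.
  suff mf : measurable_fun setT (fun w : R' * R' => nilD_param w.1 w.2) by exact: mf.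
  by apply: measurable_nproj; measurable_poly.
have -> : nilD_fiber = leb \o xsection E.
  apply/funext => x /=; rewrite -(nilD_fiberE x 0 0); congr leb.
  by apply/seteqP; split=> z; rewrite /xsection /= inE /E /= addr0.
exact: measurable_fun_xsection.
Qed.

(** x and x + 1 parametrize the same vertical circle, with origins that differ
    by x. *)
Lemma nilD_fiberS x : nilD_fiber (x + 1) = nilD_fiber x.
Proof.
rewrite -(nilD_fiberE (x + 1) 0 0) -(nilD_fiberE x 0 x); congr leb.
apply/seteqP; split=> z /=;
  by rewrite addr0 -(nilD_paramD1 x (z + x)) addrK.
Qed.

End NilDFiber.

Section HaarFormula.
Variable R : realType.
Local Notation leb := (@lebesgue_measure R).
Local Notation R' := (measurableTypeR R).

(** A Borel section of [nilD_param], which carries the Haar probability to a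
    probability on the plane, where Fubini applies. *)
Definition nilD_section (p : nilm R) : R * R :=
  xget (0, 0) [set w | [/\ 0 <= w.1 < 1, 0 <= w.2 < 1 & p = nilD_param w.1 w.2]].

Let nilD_sectionP p : nilD R p ->
  [/\ 0 <= (nilD_section p).1 < 1, 0 <= (nilD_section p).2 < 1
    & p = nilD_param (nilD_section p).1 (nilD_section p).2].
Proof.
have e : 1 + 0 = 1 :> R by rewrite addr0.
move=> /(nilD_paramP e)[x [z [xI ->]]]; rewrite oppr0 in xI.
have /andP[kz zk] := floor_itv z; set k := Num.floor z in kz zk.
rewrite /nilD_section; case: xgetP => [w -> //|/(_ (x, z - k%:~R))[]]; split=> //=.
  by rewrite rmorphD /= in zk; apply/andP; split; lra.
by rewrite /nilD_param -[in RHS](nproj_vertical _ _ _ k) subrK.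
Qed.

Let nilD_sectionK (x z : R) : 0 <= x < 1 -> 0 <= z < 1 ->
  nilD_section (nilD_param x z) = (x, z).
Proof.
move=> xI zI; have [] := nilD_sectionP (nilD_nilD_param x z).
case: (nilD_section _) => x' z' /= x'I z'I.
have e : 1 + 0 = 1 :> R by rewrite addr0.
move=> eP; have xx : x = x' by apply: (nilD_param_inj e _ _ eP); rewrite oppr0.
move: eP; rewrite -xx => /nprojP[u [ux uy uz]].
have hy0 : (hy u)%:~R = 0 :> R by lra.
have {}uz : z' = z + (hz u)%:~R by rewrite uz hy0 mulr0 addr0.
have h1 : hz u < 1 by rewrite -(ltr_int R); lra.
have h2 : - 1 < hz u by rewrite -(ltr_int R) mulrNz; lra.
have u0 : hz u = 0 by apply/eqP; rewrite eq_le -!ltzD1 add0r h1 -ltrBlDr sub0r.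
by rewrite uz u0 addr0.
Qed.

Let measurable_nilD_section : measurable_fun (nilD R) nilD_section.
Proof.
move=> _ E mE.
rewrite (_ : _ `&` _ = @coord_nproj R @` [set w : R * R * R |
   w.1.1 + w.1.2 = 0 /\ [/\ 0 <= w.1.1 < 0 + 1, 0 <= w.2 < 0 + 1 & E (w.1.1, w.2)]]).
  apply: measurable_coord_nproj_image.
  rewrite (_ : [set _ | _] = (fun w : R * R * R => w.1.1 + w.1.2) @^-1` [set 0] `&`
    ([set w | 0 <= w.1.1 < 0 + 1] `&` ([set w | 0 <= w.2 < 0 + 1] `&`
     (fun w : R * R * R => (w.1.1, w.2)) @^-1` E))); last first.
    by apply/seteqP; split=> w /=; [move=> [? []]|move=> [? [? []]]].
  apply: measurableI; [|apply: measurableI; [|apply: measurableI]].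
  - rewrite -[X in measurable X]setTI.
    suff mf : measurable_fun setT (fun w : R * R * R => w.1.1 + w.1.2) by exact: mf.
    by measurable_poly.
  - by apply: measurable_unit_itv; measurable_poly.
  - by apply: measurable_unit_itv; measurable_poly.
  - rewrite -[X in measurable X]setTI.
    suff mf : measurable_fun setT (fun w : R * R * R => (w.1.1, w.2)) by exact: mf.
    by apply: measurable_fun_pair; measurable_poly.
apply/seteqP; split=> [p [Dp Ew]|_ [[[x y] z] /= [xy0 [xI zI Exz]] <-]].
  have [w1 w2 e] := nilD_sectionP Dp.
  exists ((nilD_section p).1, - (nilD_section p).1, (nilD_section p).2) => //=.
  by rewrite subrr add0r; split=> //; split=> //; rewrite -surjective_pairing.
have -> : y = - x by lra.
rewrite add0r in xI zI.
by split; [exact: nilD_nilD_param|rewrite /= (nilD_sectionK xI zI)].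
Qed.

Let lebesgue2_sigma_finite : sigma_finite setT (leb \x leb)%E.
Proof.
have /sigma_finiteP[F [TF ndF mF]] := sigma_finiteT leb.
exists (fun n => F n `*` F n) => [|n]; last first.
  have [mFn Fn_fin] := mF n; split; first exact: measurableX.
  by rewrite product_measure1E // lte_mul_pinfty // ge0_fin_numE.
apply/seteqP; split=> // -[x y] _.
have [i _ Fix] : (\bigcup_n F n) x by rewrite -TF.
have [j _ Fjy] : (\bigcup_n F n) y by rewrite -TF.
exists (maxn i j) => //; split.
  by move: Fix; apply/subsetPset/ndF; exact: leq_maxl.
by move: Fjy; apply/subsetPset/ndF; exact: leq_maxr.
Qed.

Let lebesgue2_mixin :=
  Measure_isSigmaFinite.Build _ _ _ (leb \x leb)%E lebesgue2_sigma_finite.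

Let leb2 : {sigma_finite_measure set (R' * R')%type -> \bar R} :=
  HB.pack (leb \x leb)%E lebesgue2_mixin.

Variable mu : probability (nilm R) R.
Hypothesis mu_haar : is_haar_nilD mu.

Lemma haar_nilD_setI (B : set (nilm R)) : measurable B -> mu (nilD R `&` B) = mu B.
Proof.
move=> mB; rewrite setIC; have mD : measurable (nilD R) by exact: measurable_nilD.
have D0 : mu (~` nilD R) = 0%E by rewrite probability_setC // mu_haar.1 subee.
rewrite -[in RHS](setIT B) -(setUv (nilD R)).
have mBC : measurable (B `&` ~` nilD R) by apply: measurableI => //; exact: measurableC.
have dis : (B `&` nilD R) `&` (B `&` ~` nilD R) = set0 by rewrite setIACA setICr setI0.
rewrite setIUr measureU //; last exact: measurableI.
rewrite [X in _ = (_ + X)%E](_ : _ = 0%E) ?adde0 //.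
apply/eqP; rewrite eq_le measure_ge0 andbT -D0.
by apply: le_measure; rewrite ?inE //; exact: measurableC.
Qed.

Let sec : nilm R -> R' * R' := nilD_section.

Let measurable_sec : measurable_fun setT sec.
Proof.
rewrite -(setUv (nilD R)); apply/measurable_funU => //.
- exact: measurable_nilD.
- by apply: measurableC; exact: measurable_nilD.
split; first exact: measurable_nilD_section.
apply: (eq_measurable_fun (cst ((0, 0) : R' * R'))); last exact: measurable_cst.
move=> p /[!inE] nDp; rewrite /= /sec /nilD_section xgetPN // => w [_ _ e].
by case: nDp; rewrite e; exact: nilD_nilD_param.
Qed.

Let sec_mixin := isMeasurableFun.Build _ _ _ _ _ measurable_sec.
Let sec_mfun : {mfun nilm R >-> (R' * R')%type} := HB.pack sec sec_mixin.

Let law : probability (R' * R')%type R :=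
  distribution mu sec_mfun.

Let measurable_translate (a c : R) (B : set (nilm R)) : measurable B ->
  measurable [set w : R' * R' | B (nilD_param (w.1 + a) (w.2 + c - a * w.1))].
Proof.
move=> mB; rewrite -[X in measurable X]setTI.
suff mf : measurable_fun setT (fun w : R' * R' =>
    nilD_param (w.1 + a) (w.2 + c - a * w.1)) by exact: mf.
by apply: measurable_nproj; measurable_poly.
Qed.

(** Invariance under the translation by [a, -a, c], read in the plane. *)
Let translateE (a c : R) (B : set (nilm R)) : measurable B ->
  law [set w | B (nilD_param (w.1 + a) (w.2 + c - a * w.1))] = mu B.
Proof.
move=> mB; pose g := Heis a (- a) c.
have nact_param x z : nact g (nilD_param x z) = nilD_param (x + a) (z + c - a * x).
  by rewrite nactE; congr nproj; congr Heis => /=; ring.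
have Dg : surfD R g by rewrite /surfD /= subrr.
have mgB : measurable (nact g @^-1` B).
  apply/nilm_measurableP; rewrite -[X in measurable X]setTI.
  suff mf : measurable_fun setT (fun w : R * R * R =>
      nproj (Heis (a + w.1.1) (- a + w.1.2) (c + w.2 + a * w.1.2))).
    rewrite (_ : _ @^-1` _ = (fun w : R * R * R =>
      nproj (Heis (a + w.1.1) (- a + w.1.2) (c + w.2 + a * w.1.2))) @^-1` B); first exact: mf.
    by apply/seteqP; split=> w; rewrite /coord_nproj /preimage /= nactE.
  by apply: measurable_nproj; measurable_poly.
rewrite -[RHS](mu_haar.2 g Dg B mB) -[RHS]haar_nilD_setI // /law /distribution /pushforward.
rewrite -[LHS]haar_nilD_setI; last first.
  rewrite -[X in measurable X]setTI; apply: measurable_sec => //.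
  exact: measurable_translate.
congr (mu _); apply/seteqP; split=> p [Dp] /=; have [_ _ e] := nilD_sectionP Dp.
  by split=> //; rewrite /preimage /= [in nact _ _]e nact_param.
by rewrite [in nact _ _]e nact_param.
Qed.

(** The classical averaging argument for the uniqueness of Haar measure.  The
    quantity mu B is the mass of the points w whose translate by [a, -a, c] lies
    in B, whatever a and c; averaging over (a, c) in the unit square and
    exchanging the integrals, it becomes the mu-average of the area of the
    (a, c) that carry w into B.  As (a, c) covers a fundamental domain of D,
    that area is the integral of the fibre lengths over one period, for any w. *)
Theorem haar_nilDE (B : set (nilm R)) (u : R) : measurable B ->
  mu B = (\int[leb]_(x in `[u, (u + 1)%R[) nilD_fiber B x)%E.
Proof.
move=> mB; pose K : \bar R := (\int[leb]_(x in `[0%R, 1%R[) nilD_fiber B x)%E.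
have mF := measurable_nilD_fiber mB.
have F0 (x : R) : (0 <= nilD_fiber B x)%E by exact: fiber_measure_ge0.
have KE (v : R) : (\int[leb]_(x in `[v, (v + 1)%R[) nilD_fiber B x)%E = K.
  by apply: ge0_integral_periodic => //; exact: nilD_fiberS.
rewrite KE.
pose box : set (R' * R') := `[0, 1[%classic `*` `[0, 1[%classic.
have mbox : measurable box by apply: measurableX; exact: measurable_itv.
pose A : set ((R' * R') * (R' * R')) :=
  [set v | 0 <= v.1.1 < 0 + 1] `&` ([set v | 0 <= v.1.2 < 0 + 1] `&`
  (fun v => nilD_param (v.2.1 + v.1.1) (v.2.2 + v.1.2 - v.1.1 * v.2.1)) @^-1` B).
have mA : measurable A.
  apply: measurableI; [|apply: measurableI].
  - by apply: measurable_unit_itv; measurable_poly.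
  - by apply: measurable_unit_itv; measurable_poly.
  rewrite -[X in measurable X]setTI.
  suff mf : measurable_fun setT (fun v : (R' * R') * (R' * R') =>
    nilD_param (v.2.1 + v.1.1) (v.2.2 + v.1.2 - v.1.1 * v.2.1)) by exact: mf.
  by apply: measurable_nproj; measurable_poly.
have := indic_fubini_tonelli leb2 law mA.
rewrite indic_fubini_tonelli_FE // indic_fubini_tonelli_GE //.
have -> : law \o xsection A = cst (mu B) \_ box.
  apply/funext => v; rewrite patchE; case: ifPn => [|nv].
    rewrite inE /box /= !in_itv /= => -[v1 v2].
    rewrite -(translateE v.1 v.2 mB) /=; congr (law _); apply/seteqP; split=> w;
      by rewrite /xsection /= inE /A /= !add0r => // -[_ []].
  rewrite /= (_ : xsection A v = set0) ?measure0 //.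
  apply/seteqP; split=> w //; rewrite /xsection /= inE /A /= !add0r => -[v1 [v2 _]].
  by move: nv; rewrite notin_setE; apply; rewrite /box /= !in_itv.
rewrite -integral_mkcond integral_cst // [X in (mu B * X)%E](_ : _ = 1%E) ?mule1; last first.
  transitivity ((leb \x leb)%E box) => //.
  rewrite product_measure1E; [|exact: measurable_itv..].
  have l1 : leb `[0%R, 1%R[ = 1%E.
    by rewrite lebesgue_measure_itv /= lte_fin ltr01 EFinN oppe0 adde0.
  by transitivity (leb `[0%R, 1%R[ * leb `[0%R, 1%R[)%E; rewrite // l1 mule1.
move=> ->.
have -> : leb2 \o ysection A = cst K.
  apply/funext => w /=; rewrite /leb2 /product_measure1 /=.
  rewrite -(KE w.1) -[X in `[X, _[](add0r w.1) [(w.1 + 1)%R]addrC ge0_integral_shift //.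
  rewrite [RHS]integral_mkcond; apply: eq_integral => a _; rewrite patchE.
  case: ifPn => [|na].
    rewrite inE /= in_itv /= => aI.
    rewrite -(nilD_fiberE mB (a + w.1) 0 (w.2 - a * w.1)); congr (leb _).
    have cE c : c + (w.2 - a * w.1) = w.2 + c - a * w.1 by ring.
    apply/seteqP; split=> c; rewrite /xsection /ysection /= !inE /A /= !add0r cE.
      by rewrite inE /= (addrC a) => -[_ [? ?]].
    by rewrite inE /= (addrC a) => -[? ?].
  rewrite (_ : xsection _ _ = set0) ?measure0 //.
  apply/seteqP; split=> c //; rewrite /xsection /ysection /= !inE /A /= !add0r inE.
  by move=> -[/= aI _]; move: na; rewrite notin_setE; apply; rewrite /= in_itv.
rewrite integral_cst // [X in (K * X)%E](_ : _ = 1%E) ?mule1 //.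
exact: (@probability_setT _ _ _ law).
Qed.

End HaarFormula.

(** * Sections transferred from D along the flow *)

Section TransferSection.
Variable R : realType.
Variables al be ga : R.
Hypotheses (al_be : al + be = 1) (al_ge0 : 0 <= al) (be_ge0 : 0 <= be).
Local Notation Phi := (flow al be ga).
Local Notation T := (niltranslation al be ga).
Local Notation xc := (nilD_coord al be).
Implicit Types (p : nilm R) (B : set (nilm R)).

Variables (nS : nilm R -> nilm R) (l th e e' : R) (q : R -> R).
Hypothesis nS_inj : injective nS.
Hypothesis nS_flow : forall t p, nS (Phi t p) = Phi (l * t) (nS p).
Hypotheses (l_gt0 : 0 < l) (e_gt0 : 0 < e) (mq : measurable_fun setT q).
Hypotheses (step_al : 0 < l + th * al) (step_be : 0 < l - th * be).
Hypothesis nS_param : forall x z : R,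
  Phi (th * x) (nS (nilD_param x z)) = nproj (Heis (e * x) (e' * x) (z + q x)).

(** A bijection nS of the nilmanifold that multiplies the time of the flow by
    l > 0 carries D to another section of the flow, and [transfer] slides this
    section along the orbits, by a time th * x, linear in the coordinate of D.
    Two choices of (nS, l, th) are of interest: the identity of the nilmanifold,
    with th such that D becomes [Sigma]; and a contraction of the transverse
    direction, with th such that D is carried into itself. *)
Definition transfer p : nilm R := Phi (th * xc p) (nS p).
Local Notation G := transfer.
Local Notation GD := (transfer @` nilD R).

(** The time from G p to G (Phi j p), for an integer j: see [transfer_flow]. *)
Definition transfer_time p (j : int) : R :=
  l * j%:~R + th * (xc (Phi j%:~R p) - xc p).

Let nilD_int p (j : int) : nilD R p -> nilD R (Phi j%:~R p).
Proof. by move=> Dp; apply/nilD_flow => //; exact: intr_int. Qed.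

Lemma transfer_flow p (j : int) :
  Phi (transfer_time p j) (G p) = G (Phi j%:~R p).
Proof. by rewrite /transfer nS_flow !flowD; congr flow; rewrite /transfer_time; ring. Qed.

(** Undoing the slide and then nS, which is injective, shows that p and p' are on
    the same orbit; being both in D, they are an integer time apart. *)
Lemma transfer_hit p p' t : nilD R p -> nilD R p' -> Phi t (G p) = G p' ->
  exists2 j : int, p' = Phi j%:~R p & t = transfer_time p j.
Proof.
move=> Dp Dp'; rewrite /transfer flowD => /(congr1 (Phi (- (th * xc p')))).
rewrite !flowD addNr flow0; set s := _ + _ => e0.
have : nS p' = nS (Phi (s / l) p).
  by rewrite nS_flow mulrCA divff ?gt_eqF // mulr1.
move=> /nS_inj p'E; have : s / l \is a Num.int.
  by apply/(nilD_flow ga al_be _ Dp); rewrite -p'E.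
move=> /intrP[j sj]; rewrite sj in p'E; exists j => //.
rewrite /transfer_time -p'E -sj /s; field; exact: lt0r_neq0.
Qed.

(** One step of j adds l + th * (x' - x), where x' - x is al or - be by
    [nilD_coord_niltranslation]: both values are positive. *)
Lemma transfer_time_lt p (j k : int) : nilD R p -> j < k ->
  transfer_time p j < transfer_time p k.
Proof.
move=> Dp; have step i : transfer_time p i < transfer_time p (i + 1).
  rewrite -subr_gt0 /transfer_time rmorphD /= [_%:~R + 1]addrC -flowD -niltranslationE.
  have := nilD_coord_niltranslation ga al_be al_ge0 be_ge0 (nilD_int i Dp).
  set a := xc (T _); set b := xc (Phi _ p) => /= ab.
  have -> : l * (1 + i%:~R) + th * (a - xc p) - (l * i%:~R + th * (b - xc p)) =
    l + th * (a - b) by ring.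
  by case: ab => ->; rewrite ?mulrN.
have up (n : nat) : transfer_time p j < transfer_time p (j + n.+1%:Z).
  elim: n => [|n IH]; first exact: step.
  by apply: lt_trans IH _; rewrite -(addn1 n.+1) PoszD addrA; exact: step.
move=> jk; have : 0 < k - j by rewrite subr_gt0.
case kj: (k - j) => [[|n]|n] // _.
by have -> : k = j + n.+1%:Z by rewrite -kj addrC subrK.
Qed.

Let transfer_time0 p : transfer_time p 0 = 0.
Proof. by rewrite /transfer_time flow0; ring. Qed.

Lemma transfer_inj p p' : nilD R p -> nilD R p' -> G p = G p' -> p = p'.
Proof.
move=> Dp Dp' GG; have [|j -> tj] := @transfer_hit p p' 0 Dp Dp'.
  by rewrite flow0.
suff -> : j = 0 by rewrite flow0.
by have [/(transfer_time_lt Dp)|/(transfer_time_lt Dp)|//] := ltgtP j 0;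
  rewrite -tj transfer_time0 ltxx.
Qed.

(** The times at which the orbit of G p is in G(D) are the values of
    [transfer_time p], which increase and vanish at 0, so the first positive one
    is the value at 1. *)
Lemma transfer_return_time p : nilD R p ->
  is_return_time Phi GD (G p) (transfer_time p 1).
Proof.
move=> Dp; split.
- by rewrite -(transfer_time0 p); exact: transfer_time_lt.
- by rewrite transfer_flow; exists (Phi 1%:~R p) => //; exact: nilD_int.
move=> s /andP[s0 s1] [p' Dp' /esym /(transfer_hit Dp Dp')[j _ sj]].
have j0 : 0 < j.
  rewrite ltNge le_eqVlt; apply/negP => /orP[/eqP j0|/(transfer_time_lt Dp)].
    by move: s0; rewrite sj j0 transfer_time0 ltxx.
  by rewrite -sj transfer_time0 ltNge (ltW s0).
have : 1 <= j by rewrite -gtz0_ge1.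
rewrite le_eqVlt => /orP[/eqP j1|/(transfer_time_lt Dp)].
  by move: s1; rewrite sj -j1 ltxx.
by rewrite -sj ltNge (ltW s1).
Qed.

Lemma transfer_niltranslation p :
  Phi (transfer_time p 1) (G p) = G (T p).
Proof. by rewrite transfer_flow niltranslationE. Qed.

Let alE : al = - be + 1. Proof. by rewrite -al_be; ring. Qed.

Lemma transfer_param (x z : R) : - be <= x < al ->
  G (nilD_param x z) = nproj (Heis (e * x) (e' * x) (z + q x)).
Proof. by move=> xI; rewrite /transfer nilD_coordE // nS_param. Qed.

(** In coordinates the transfer is affine in x and a vertical shift depending on
    x, so it has an inverse of the same form. *)
Lemma transfer_imageP B (x z : R) : - be <= x < al ->
  (G @` (nilD R `&` B)) (nproj (Heis (e * x) (e' * x) z)) <->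
  B (nilD_param x (z - q x)).
Proof.
move=> xI; have GE : G (nilD_param x (z - q x)) = nproj (Heis (e * x) (e' * x) z).
  by rewrite transfer_param // subrK.
rewrite -GE; split=> [[p [Dp Bp] /transfer_inj <- //]|?].
  exact: nilD_nilD_param.
by exists (nilD_param x (z - q x)) => //; split=> //; exact: nilD_nilD_param.
Qed.

Lemma measurable_transfer_image B : measurable B ->
  measurable (G @` (nilD R `&` B)).
Proof.
move=> mB.
have eK (x : R) : e * (x / e) = x by rewrite mulrC divfK ?gt_eqF.
pose W : set (R * R * R) := [set w | - be <= w.1.1 / e < - be + 1] `&`
  ((fun w : R * R * R => w.1.2 - e' * (w.1.1 / e)) @^-1` [set 0] `&`
   (fun w : R * R * R => nilD_param (w.1.1 / e) (w.2 - q (w.1.1 / e))) @^-1` B).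
have me : measurable_fun setT (fun w : R * R * R => w.1.1 / e) by measurable_poly.
rewrite (_ : G @` _ = @coord_nproj R @` W).
  apply: measurable_coord_nproj_image.
  apply: measurableI; [exact: measurable_unit_itv|apply: measurableI].
    rewrite -[X in measurable X]setTI.
    suff mf : measurable_fun setT
      (fun w : R * R * R => w.1.2 - e' * (w.1.1 / e)) by exact: mf.
    by measurable_poly.
  rewrite -[X in measurable X]setTI.
  suff mf : measurable_fun setT
    (fun w : R * R * R => nilD_param (w.1.1 / e) (w.2 - q (w.1.1 / e))) by exact: mf.
  apply: measurable_nproj => //; first exact: measurable_funN.
  by apply: measurable_funB; [measurable_poly|exact: measurableT_comp].
apply/seteqP; split=> [_ [_ [/(nilD_paramP al_be)[x [z [xI ->]]] Bp] <-]|].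
  have xe : e * x / e = x by rewrite mulrAC divff ?gt_eqF // mul1r.
  exists (e * x, e' * x, z + q x); last by rewrite transfer_param.
  by rewrite /W /= xe -alE addrK subrr.
move=> _ [[[x y] z] [/= + [/= xy Bxz]] <-]; rewrite -alE => xI.
have /eqP yE : y == e' * (x / e) by rewrite -subr_eq0 xy.
by rewrite /coord_nproj /triple_heis /= yE -{1}(eK x); apply/(transfer_imageP B z xI).
Qed.

Lemma measurable_transfer_preimage B : measurable B ->
  measurable (nilD R `&` G @^-1` B).
Proof.
move=> mB.
pose W : set (R * R * R) := [set w | - be <= w.1.1 < - be + 1] `&`
  ((fun w : R * R * R => w.1.2 + w.1.1) @^-1` [set 0] `&`
   (fun w : R * R * R =>
      nproj (Heis (e * w.1.1) (e' * w.1.1) (w.2 + q w.1.1))) @^-1` B).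
have m1 : measurable_fun setT (fun w : R * R * R => w.1.1) by measurable_poly.
rewrite (_ : nilD R `&` _ = @coord_nproj R @` W).
  apply: measurable_coord_nproj_image.
  apply: measurableI; [exact: measurable_unit_itv|apply: measurableI].
    rewrite -[X in measurable X]setTI.
    suff mf : measurable_fun setT
      (fun w : R * R * R => w.1.2 + w.1.1) by exact: mf.
    by measurable_poly.
  rewrite -[X in measurable X]setTI.
  suff mf : measurable_fun setT (fun w : R * R * R =>
    nproj (Heis (e * w.1.1) (e' * w.1.1) (w.2 + q w.1.1))) by exact: mf.
  apply: measurable_nproj; [by measurable_poly..|].
  by apply: measurable_funD; [measurable_poly|exact: measurableT_comp].
apply/seteqP; split=> [_ [/(nilD_paramP al_be)[x [z [xI ->]]] Bp]|].
  exists (x, - x, z) => //; split; first by rewrite /= -alE.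
  by split; rewrite /= ?addNr // -transfer_param.
move=> _ [[[x y] z] [/= xI [/= /eqP y0 Bp]] <-]; rewrite -alE in xI.
have /eqP -> : y == - x by rewrite -addr_eq0.
by split; [exact: nilD_nilD_param|rewrite /= transfer_param].
Qed.

(** The transfer maps vertical circles isometrically to vertical circles. *)
Lemma transfer_fiber B (x c : R) : measurable B -> - be <= x < al ->
  @lebesgue_measure R [set z | c <= z < c + 1 /\
    (G @` (nilD R `&` B)) (nproj (Heis (e * x) (e' * x) z))] = nilD_fiber B x.
Proof.
move=> mB xI; rewrite -(nilD_fiberE mB x c (- q x)); congr lebesgue_measure.
by apply/seteqP; split=> z /= [zI] /(transfer_imageP B z xI).
Qed.

Definition transfer_inv p : nilm R :=
  xget point [set p' | nilD R p' /\ G p' = p].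

Lemma transferK p : nilD R p -> transfer_inv (G p) = p.
Proof.
move=> Dp; rewrite /transfer_inv; case: xgetP => [p' _ [Dp' /transfer_inj]|/(_ p)[]] //.
by apply.
Qed.

(** If f is the first return to G(D), the transfer conjugates the niltranslation
    to f by [transfer_niltranslation]; [transfer_inv] is the conjugacy in the
    other direction, and its preimages are images under the transfer. *)
Lemma transfer_conjugate (mu1 mu2 : set (nilm R) -> \bar R) (f : nilm R -> nilm R) :
  mu1 set0 = 0%E -> mu2 set0 = 0%E ->
  (forall p, nilD R p -> f (G p) = G (T p)) ->
  (forall B, measurable B ->
    normalized mu1 GD (G @` (nilD R `&` B)) = normalized mu2 (nilD R) (nilD R `&` B)) ->
  measurably_conjugate mu1 GD f mu2 (nilD R) T.
Proof.
move=> mu10 mu20 fG muE.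
have preE B : GD `&` transfer_inv @^-1` B = G @` (nilD R `&` B).
  apply/seteqP; split=> [_ [[p Dp <-]]|_ [p [Dp Bp] <-]].
    by rewrite /= transferK // => Bp; exists p.
  by split; [exists p|rewrite /= transferK].
exists GD, (nilD R), transfer_inv; split=> //.
- by rewrite -[nilD R]setIT; exact: measurable_transfer_image.
- exact: measurable_nilD.
- by rewrite setDv.
- by rewrite setDv.
- by move=> _ [p Dp <-]; rewrite fG //; exists (T p) => //; exact: nilD_niltranslation.
- split=> [_ [p Dp <-]|p1 p2|p Dp]; first by rewrite transferK.
    move=> /set_mem[p1' Dp1' <-] /set_mem[p2' Dp2' <-].
    by rewrite !transferK // => ->.
  by exists (G p); [exists p|rewrite transferK].
- by move=> _ B mB; rewrite preE; exact: measurable_transfer_image.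
- move=> B mB; rewrite [X in measurable X](_ : _ = nilD R `&` G @^-1` B).
    exact: measurable_transfer_preimage mB.
  apply/seteqP; split=> [_ [_ [[p Dp <-] Bp] <-]|p [Dp Bp]].
    by rewrite transferK.
  by exists (G p); [split=> //; exists p|rewrite transferK].
- by move=> B mB; rewrite preE muE.
- by move=> _ [p Dp <-]; rewrite fG // !transferK //; exact: nilD_niltranslation.
Qed.

End TransferSection.

(** * Return maps *)

Section Returns.
Variable R : realType.

Lemma is_return_time_uniq (X : Type) (Phi : R -> X -> X) (S : set X) x t t' :
  is_return_time Phi S x t -> is_return_time Phi S x t' -> t = t'.
Proof.
move=> [t0 St nt] [t'0 St' nt']; have [tt|tt|//] := ltgtP t t'.
  by case: (nt' t); rewrite ?t0.
by case: (nt t'); rewrite ?t'0.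
Qed.

Lemma return_mapE (X : Type) (Phi : R -> X -> X) (S : set X) x t :
  is_return_time Phi S x t -> return_map Phi S x = Phi t x.
Proof.
move=> St; rewrite /return_map /return_time.
case: xgetP => [t' _ /(is_return_time_uniq St) <- //|/(_ t)]; by case.
Qed.

Lemma is_return_index_uniq (X : Type) (f : X -> X) (A : set X) x m n :
  is_return_index f A x m -> is_return_index f A x n -> m = n.
Proof.
move=> [m0 Am nm] [n0 An nn]; have [mn|mn|//] := ltngtP m n.
  by case: (nn m); rewrite ?m0.
by case: (nm n); rewrite ?n0.
Qed.

(** A subset of D can only be reached at integer times, so its first return under
    the flow is its first return under the niltranslation. *)
Lemma induced_mapE (al be ga : R) (A : set (nilm R)) (p : nilm R) (t : R) :
  al + be = 1 -> A `<=` nilD R -> A p ->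
  is_return_time (flow al be ga) A p t ->
  induced_map (niltranslation al be ga) A p = flow al be ga t p.
Proof.
move=> al_be AD Ap [t0 At nt].
have : t \is a Num.int by apply/(nilD_flow ga al_be t (AD _ Ap)); exact: AD.
move=> /intrP[[n|n] tn]; last by move: t0; rewrite tn ltr0z.
have iP : is_return_index (niltranslation al be ga) A p n.
  split; first by move: t0; rewrite tn ltr0z.
    by rewrite iter_niltranslation -[n%:R]/((Posz n)%:~R) -tn.
  move=> m /andP[m0 mn]; rewrite iter_niltranslation; apply: nt.
  by rewrite ltr0n m0 tn -pmulrn ltr_nat.
rewrite /induced_map; case: xgetP => [m _ /(is_return_index_uniq iP) <-|/(_ n)].
  by rewrite iter_niltranslation tn pmulrn.
by case.
Qed.

End Returns.

(** * Integral automorphisms of the nilmanifold *)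

Section Automorphism.
Variable R : realType.
Variables A B C D na nb : int.
Local Notation d := (A * D - B * C).

(** In the coordinates (x, y, z - xy/2) of the Lie algebra this is the linear map
    with matrix (A B; C D) on (x, y) and
    w |-> d w + (na - AC/2) x + (nb - BD/2) y, so it is the automorphism that
    sends [1, 0, 0] to [A, C, na] and [0, 1, 0] to [B, D, nb].  Written with
    x (x - 1) / 2 and y (y - 1) / 2, the last coordinate has integer coefficients
    in quantities that are integers on the lattice. *)
Definition heis_aut (g : heis R) : heis R :=
  Heis (A%:~R * hx g + B%:~R * hy g) (C%:~R * hx g + D%:~R * hy g)
    (d%:~R * hz g + na%:~R * hx g + nb%:~R * hy g
     + (A * C)%:~R * (hx g * (hx g - 1) / 2)
     + (B * D)%:~R * (hy g * (hy g - 1) / 2) + (B * C)%:~R * (hx g * hy g)).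

Lemma heis_autM g h : heis_aut (g * h)%g = (heis_aut g * heis_aut h)%g.
Proof. by congr Heis => /=; rewrite ?(intrB, intrM); field. Qed.

Lemma measurable_heis_aut (f g h : R -> R) :
  measurable_fun setT f -> measurable_fun setT g -> measurable_fun setT h ->
  let k x := heis_aut (Heis (f x) (g x) (h x)) in
  [/\ measurable_fun setT (fun x => hx (k x)), measurable_fun setT (fun x => hy (k x))
    & measurable_fun setT (fun x => hz (k x))].
Proof.
move=> mf mg mh /=; split;
  repeat first [ exact: mf | exact: mg | exact: mh | apply: measurable_funD
               | apply: measurable_funB | apply: measurable_funM
               | exact: measurable_cst ].
Qed.

(** The hypotheses say that (al, be, ga) is an eigenvector of the automorphism in
    the Lie algebra; [flow_elt] is its one-parameter group. *)
Lemma heis_aut_flow_elt (al be ga l t : R) :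
  A%:~R * al + B%:~R * be = l * al -> C%:~R * al + D%:~R * be = l * be ->
  al * (na%:~R - (A * C)%:~R / 2) + be * (nb%:~R - (B * D)%:~R / 2) =
    ga * (l - d%:~R) ->
  heis_aut (flow_elt al be ga t) = flow_elt al be ga (l * t).
Proof.
move=> e1 e2 e3; rewrite /heis_aut /flow_elt /=; congr Heis.
- by rewrite !mulrA -mulrDl e1; ring.
- by rewrite !mulrA -mulrDl e2; ring.
rewrite (_ : al * be / 2 * (l * t) ^+ 2 = (l * al) * (l * be) / 2 * t ^+ 2); last by ring.
have -> : ga * (l * t) = (ga * (l - d%:~R) + ga * d%:~R) * t by ring.
by rewrite -e1 -e2 -e3 !(intrB, intrM); field.
Qed.

Let half_int (z : int) : exists k : int, z * (z - 1) = k * 2.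
Proof.
elim/int_rec: z => [|n [k IH]|n [k IH]]; first by exists 0.
  by exists (k + n%:Z); rewrite mulrDl -IH; ring.
by exists (k + n%:Z + 1); rewrite !mulrDl -IH; ring.
Qed.

Let heis_aut_intr (x y : int) : exists k : int, forall z : int,
  heis_aut (heis_intr R (Heis x y z)) =
  heis_intr R (Heis (A * x + B * y) (C * x + D * y) (d * z + k)).
Proof.
have [kx ex] := half_int x; have [ky ey] := half_int y.
exists (na * x + nb * y + A * C * kx + B * D * ky + B * C * (x * y)) => z.
have half (u k : int) : u * (u - 1) = k * 2 ->
    (u%:~R : R) * (u%:~R - 1) / 2 = k%:~R.
  move=> /(congr1 (fun v : int => v%:~R : R)); rewrite !(intrM, intrB) => ->.
  by rewrite mulfK.
rewrite /heis_aut /heis_intr /=; congr Heis; rewrite ?(half _ _ ex) ?(half _ _ ey);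
  by rewrite ?(intrD, intrM, intrB); ring.
Qed.

Lemma heis_aut_Gamma (u : Gamma) : exists v : Gamma,
  heis_aut (heis_intr R u) = heis_intr R v.
Proof.
by case: u => x y z; have [k ->] := heis_aut_intr x y; eexists.
Qed.

Hypothesis d_unit : d * d = 1.

(** The (x, y) part has an integral inverse since d is a unit, and then z is
    found by solving d * z + k = hz u. *)
Lemma heis_aut_Gamma_onto (u : Gamma) : exists v : Gamma,
  heis_aut (heis_intr R v) = heis_intr R u.
Proof.
have [k kE] := heis_aut_intr (d * (D * hx u - B * hy u)) (d * (A * hy u - C * hx u)).
exists (Heis (d * (D * hx u - B * hy u)) (d * (A * hy u - C * hx u)) (d * (hz u - k))).
rewrite kE; congr heis_intr.
case: u {kE} => x y z /=; congr Heis.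
- by rewrite -[RHS]mul1r -d_unit; ring.
- by rewrite -[RHS]mul1r -d_unit; ring.
- by rewrite mulrA d_unit; ring.
Qed.

Let dR_unit : (d%:~R : R) * d%:~R = 1.
Proof. by rewrite -intrM d_unit. Qed.

Lemma heis_aut_inj : injective heis_aut.
Proof.
have dR0 : (d%:~R : R) != 0.
  by apply/eqP => d0; move: dR_unit; rewrite d0 mul0r => /esym/eqP; rewrite oner_eq0.
move=> [x y z] [x' y' z'] [ex ey].
have dE : (d%:~R : R) = A%:~R * D%:~R - B%:~R * C%:~R by rewrite intrB !intrM.
have -> : x = x'.
  apply: (mulfI dR0); rewrite dE.
  rewrite (_ : _ * x = D%:~R * (A%:~R * x + B%:~R * y) - B%:~R * (C%:~R * x + D%:~R * y)).
    by rewrite ex ey; ring.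
  by ring.
have -> : y = y'.
  apply: (mulfI dR0); rewrite dE.
  rewrite (_ : _ * y = A%:~R * (C%:~R * x + D%:~R * y) - C%:~R * (A%:~R * x + B%:~R * y)).
    by rewrite ex ey; ring.
  by ring.
by do 5!move/addIr; move/(mulfI dR0) ->.
Qed.

Definition nilm_aut (p : nilm R) : nilm R := nproj (heis_aut (repr p)).

Lemma nilm_autE g : nilm_aut (nproj g) = nproj (heis_aut g).
Proof.
rewrite /nilm_aut; have /nprojP[u {2}->] : nproj (repr (nproj g)) = nproj g.
  by rewrite /nproj reprK.
have [v vE] := heis_aut_Gamma u.
by rewrite heis_autM vE nproj_mul_Gamma.
Qed.

Lemma nilm_aut_inj : injective nilm_aut.
Proof.
move=> p p'; have [g ->] := nproj_surj p; have [h ->] := nproj_surj p'.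
rewrite !nilm_autE => /nprojP[u]; have [v <-] := heis_aut_Gamma_onto u.
by rewrite -heis_autM => /heis_aut_inj ->; rewrite nproj_mul_Gamma.
Qed.

Lemma nilm_aut_flow (al be ga l t : R) (p : nilm R) :
  A%:~R * al + B%:~R * be = l * al -> C%:~R * al + D%:~R * be = l * be ->
  al * (na%:~R - (A * C)%:~R / 2) + be * (nb%:~R - (B * D)%:~R / 2) =
    ga * (l - d%:~R) ->
  nilm_aut (flow al be ga t p) = flow al be ga (l * t) (nilm_aut p).
Proof.
move=> e1 e2 e3; have [g ->] := nproj_surj p.
by rewrite flow_nproj !nilm_autE flow_nproj heis_autM (heis_aut_flow_elt _ e1 e2 e3).
Qed.

(** The automorphism acts on the centre by d, and its square trivially. *)
Lemma heis_aut2_vertical (x y z : R) :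
  heis_aut (heis_aut (Heis x y z)) =
  Heis (hx (heis_aut (heis_aut (Heis x y 0)))) (hy (heis_aut (heis_aut (Heis x y 0))))
    (z + hz (heis_aut (heis_aut (Heis x y 0)))).
Proof.
congr Heis => //; have zE : z = d%:~R * d%:~R * z by rewrite dR_unit mul1r.
by rewrite [X in _ = X + _]zE /=; ring.
Qed.

End Automorphism.

(** * The section Sigma *)

Section Sections.
Variable R : realType.
Local Notation leb := (@lebesgue_measure R).

Lemma eigen_coords (M : 'M[int]_2) (a b l : R) :
  map_mx intr M *m vec2 a b = l *: vec2 a b ->
  (M 0 0)%:~R * a + (M 0 1)%:~R * b = l * a /\
  (M 1 0)%:~R * a + (M 1 1)%:~R * b = l * b.
Proof.
move=> /matrixP e; have := e 0 0; have := e 1 0.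
rewrite !mxE !big_ord_recl !big_ord0 !mxE /= !addr0.
have -> : lift ord0 ord0 = 1 :> 'I_2 by exact: val_inj.
by move=> e1 e0; split; [exact: e0|exact: e1].
Qed.

Lemma sqrt_sqr_quotient (k Delta w : R) : 0 <= k -> Delta < 0 ->
  w = (k / Delta) ^+ 2 -> Num.sqrt w = k / - Delta.
Proof.
move=> k0 D0 ->; rewrite sqrtr_sqr invrN mulrN ler0_norm //.
by rewrite mulr_ge0_le0 // invr_le0 ltW.
Qed.

Variables (al be ga al' be' : R) (mu : probability (nilm R) R).
Hypotheses (al_ge0 : 0 <= al) (be_ge0 : 0 <= be) (al_be : al + be = 1).
Hypotheses (al'_gt0 : 0 < al') (be'_lt0 : be' < 0).
Hypothesis mu_haar : is_haar_nilD mu.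
Local Notation Phi := (flow al be ga).
Local Notation T := (niltranslation al be ga).

(** In the basis (al, be), (al', be') of the plane, (1, -1) has the coordinates
    - shear and 1 / covol.  Thus the point (x, -x) of the plane of D reaches the
    line of direction (al', be') after the time shear * x, at
    (al', be') * (x / covol). *)
Definition covol : R := al' * be - al * be'.
Definition shear : R := (al' + be') / covol.

Lemma covol_gt0 : 0 < covol.
Proof.
rewrite /covol -mulrN; move: al_ge0; rewrite le_eqVlt => /orP[/eqP al0|al_gt0].
  by move: al_be; rewrite -al0 add0r mul0r addr0 => ->; rewrite mulr1.
by apply: ltr_wpDl; [rewrite mulr_ge0 // ltW|rewrite mulr_gt0 // oppr_gt0].
Qed.

Lemma shear_al : 1 + shear * al = al' / covol.
Proof.
have c0 := lt0r_neq0 covol_gt0; rewrite /shear -[1](divff c0) -mulrAC -mulrDl.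
by congr (_ / _); rewrite /covol -[al' in RHS]mulr1 -al_be; ring.
Qed.

Lemma shear_be : 1 - shear * be = - be' / covol.
Proof.
have c0 := lt0r_neq0 covol_gt0; rewrite /shear -[1](divff c0) -mulrAC -mulrBl.
by congr (_ / _); rewrite /covol -[be' in RHS]mulr1 -al_be; ring.
Qed.

Let alE : al = - be + 1. Proof. by rewrite -al_be; ring. Qed.

Lemma haar_nilDE_box (B : set (nilm R)) : measurable B ->
  mu B = (\int[leb]_(x in `[(- be)%R, al[) nilD_fiber B x)%E.
Proof. by move=> mB; rewrite alE; exact: haar_nilDE. Qed.

Lemma normalized_scale (mu1 : set (nilm R) -> \bar R) (G : nilm R -> nilm R) (r : R) :
  0 < r ->
  (forall B, measurable B -> mu1 (G @` (nilD R `&` B)) = (r%:E * mu B)%E) ->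
  forall B, measurable B -> normalized mu1 (G @` nilD R) (G @` (nilD R `&` B)) =
    normalized mu (nilD R) (nilD R `&` B).
Proof.
move=> r0 muE B mB; rewrite /normalized.
rewrite (setIidr (_ : G @` (nilD R `&` B) `<=` G @` nilD R)); last first.
  by move=> _ [p [Dp _] <-]; exists p.
rewrite muE // setIA setIid haar_nilD_setI // mu_haar.1 /= invr1 mule1.
rewrite -[nilD R]setIT muE // probability_setT mule1 /=.
by rewrite -muleA muleC -muleA -EFinM mulVf ?gt_eqF // mule1.
Qed.

Section SigmaSection.
Variables (d_a d_b : R) (Q : R -> R -> R).
Hypotheses (d_aE : d_a = be / covol) (d_bE : d_b = al / covol).
Local Notation Sig := (Sigma al' be' d_a d_b Q).

Let c0 := lt0r_neq0 covol_gt0.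

Let q (x : R) : R := hz (flow_elt al be ga (shear * x) * Heis x (- x) 0)%g.

Let mq : measurable_fun setT q.
Proof. by rewrite /q /=; measurable_poly. Qed.

Let id_flow (t : R) (p : nilm R) : id (Phi t p) = Phi (1 * t) (id p).
Proof. by rewrite mul1r. Qed.

Let id_param (x z : R) : Phi (shear * x) (id (nilD_param x z)) =
  nproj (Heis (al' / covol * x) (be' / covol * x) (z + q x)).
Proof.
rewrite /nilD_param flow_nproj; congr nproj; congr Heis; rewrite /q /=.
- by rewrite -shear_al; ring.
- by rewrite -[be']opprK mulNr -shear_be; ring.
- by ring.
Qed.

Let al1 : 0 < 1 + shear * al. Proof. by rewrite shear_al divr_gt0 // covol_gt0. Qed.
Let be1 : 0 < 1 - shear * be.
Proof. by rewrite shear_be divr_gt0 ?oppr_gt0 // covol_gt0. Qed.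
Let e_gt0 : 0 < al' / covol. Proof. by rewrite divr_gt0 // covol_gt0. Qed.

Local Notation G := (transfer al be ga id shear).

Let rangeE (s : R) : (- d_a <= s < d_b) = (- be <= covol * s < al).
Proof.
have c1 := covol_gt0.
by rewrite d_aE d_bE -mulNr ler_pdivrMr // ltr_pdivlMr // [s * _]mulrC.
Qed.

Let scaleE (u s : R) : u / covol * (covol * s) = u * s.
Proof. by rewrite mulrA divfK. Qed.

(** Sliding D along the flow by the time shear * x gives [Sigma]: both consist of
    whole vertical circles, over segments that correspond by s = x / covol.  The
    function Q only selects a representative of height at most 1/2 from it. *)
Lemma Sigma_transfer : Sig = G @` nilD R.
Proof.
apply/seteqP; split=> [_ [[s z] [/= + _] <-]|_ [p /(nilD_paramP al_be)[x [z [xI ->]]] <-]].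
  rewrite rangeE => sI; rewrite /Sigma_param /= -(scaleE al') -(scaleE be').
  rewrite -[nilD R]setIT; apply/(transfer_imageP al_be al_ge0 be_ge0
    (@inj_id _) id_flow ltr01 al1 be1 id_param) => //.
rewrite (transfer_param al_be id_param) //.
set Qx := Q (al' / covol * x) (be' / covol * x).
have /andP[kz zk] := floor_itv (z + q x - Qx + 1 / 2).
set k := Num.floor _ in kz zk; rewrite rmorphD /= in zk.
have swap u : u * (x / covol) = u / covol * x by rewrite mulrCA mulrC.
exists (x / covol, z + q x - k%:~R).
  split; first by rewrite rangeE mulrC divfK.
  by rewrite /= !swap -/Qx; apply/andP; split; lra.
rewrite /Sigma_param /= !swap.
by rewrite -[LHS](nproj_vertical _ _ _ k) subrK.
Qed.

(** By Fubini, both sides are integrals of fibre lengths, over segments related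
    by the factor covol. *)
Lemma Sigma_measure_transfer (B : set (nilm R)) : measurable B ->
  Sigma_measure al' be' d_a d_b Q (G @` (nilD R `&` B)) = ((covol^-1)%:E * mu B)%E.
Proof.
move=> mB; rewrite /Sigma_measure /product_measure1.
pose F s : \bar R := nilD_fiber B (covol * s).
rewrite (_ : (fun _ => _) = F \_ `[(- be / covol)%R, (al / covol)%R[); last first.
  apply/funext => s; rewrite patchE mem_setE in_itv /= mulNr -d_aE -d_bE.
  set Qs := Q (al' * s) (be' * s).
  have halves : Qs - 1 / 2 + 1 = Qs + 1 / 2 by field.
  case: ifPn => sI.
    rewrite /F -(transfer_fiber al_be al_ge0 be_ge0 (@inj_id _) id_flow ltr01 al1 be1
      id_param (Qs - 1 / 2)) // -?rangeE //.
    congr leb; apply/seteqP; split=> z; rewrite /xsection /= inE /=;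
      by rewrite /Sigma_param !scaleE halves => -[] // [].
  rewrite (_ : xsection _ _ = set0) ?measure0 //.
  apply/seteqP; split=> z //; rewrite /xsection /= inE /= => -[[/= sI' _] _].
  by rewrite sI' in sI.
rewrite -integral_mkcond haar_nilDE_box //.
have -> : `[(- be)%R, al[%classic =
    `[(covol * (- be / covol))%R, (covol * (al / covol))%R[%classic :> set R.
  by rewrite ![covol * _]mulrC !divfK.
rewrite (@ge0_integral_scale _ covol (- be / covol) (al / covol)) ?covol_gt0 //;
  last exact: measurable_nilD_fiber mB.
by rewrite muleA -EFinM mulVf // mul1e.
Qed.

Lemma Sigma_returns (p : nilm R) : Sig p -> exists t, is_return_time Phi Sig p t.
Proof.
rewrite Sigma_transfer => -[{}p Dp <-]; eexists.
exact: (transfer_return_time al_be al_ge0 be_ge0 (@inj_id _) id_flow ltr01 al1 be1).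
Qed.

Lemma Sigma_conjugate : measurably_conjugate (Sigma_measure al' be' d_a d_b Q) Sig
  (return_map Phi Sig) mu (nilD R) T.
Proof.
rewrite Sigma_transfer.
apply: (transfer_conjugate al_be al_ge0 be_ge0 (@inj_id _) id_flow ltr01 e_gt0 mq
  al1 be1 id_param).
- have := Sigma_measure_transfer measurable0.
  by rewrite setI0 image_set0 measure0 mule0.
- exact: measure0.
- move=> p Dp.
  rewrite (return_mapE (transfer_return_time al_be al_ge0 be_ge0 (@inj_id _) id_flow
    ltr01 al1 be1 Dp)).
  exact: transfer_niltranslation.
- apply: normalized_scale; last exact: Sigma_measure_transfer.
  by rewrite invr_gt0 covol_gt0.
Qed.

End SigmaSection.
(** * Self-induction *)

Section SelfInduced.
Variables (A B C D na nb : int) (lam lam' : R).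
Local Notation d := (A * D - B * C).
Hypothesis lam_x : A%:~R * al + B%:~R * be = lam * al.
Hypothesis lam_y : C%:~R * al + D%:~R * be = lam * be.
Hypothesis lam'_x : A%:~R * al' + B%:~R * be' = lam' * al'.
Hypothesis lam'_y : C%:~R * al' + D%:~R * be' = lam' * be'.
Hypothesis lam_ga :
  al * (na%:~R - (A * C)%:~R / 2) + be * (nb%:~R - (B * D)%:~R / 2) = ga * (lam - d%:~R).
Hypotheses (lam_lam' : `|lam * lam'| = 1) (lam_gt : `|lam'| < `|lam|).

Let c0 := lt0r_neq0 covol_gt0.

(** The two eigenvectors span the plane, so the determinant of the matrix is the
    product of the two eigenvalues. *)
Lemma det_lam : d%:~R = lam * lam'.
Proof.
apply: (mulIf c0); rewrite /covol intrB !intrM.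
have -> : lam * lam' * (al' * be - al * be') =
  lam' * al' * (lam * be) - lam * al * (lam' * be') by ring.
by rewrite -lam_x -lam_y -lam'_x -lam'_y; ring.
Qed.

Let lam_lam'_sqr : lam ^+ 2 * lam' ^+ 2 = 1.
Proof. by rewrite -exprMn -(real_normK (num_real _)) lam_lam' expr1n. Qed.

Lemma det_unit : d * d = 1.
Proof.
by apply: (@intr_inj R); rewrite intrM det_lam -lam_lam'_sqr; ring.
Qed.

Let lam'_gt0 : 0 < lam' ^+ 2.
Proof.
rewrite exprn_even_gt0 //=; apply/eqP => l0.
by move: lam_lam'_sqr; rewrite l0 expr0n mulr0 => /esym/eqP; rewrite oner_eq0.
Qed.

Let lam_gt2 : lam' ^+ 2 < lam ^+ 2.
Proof. by rewrite -(real_normK (num_real lam)) -(real_normK (num_real lam')) ltr_pXn2r // ?nnegrE. Qed.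

Let lam'_lt1 : lam' ^+ 2 < 1.
Proof.
have [? ?] := (lam_lam'_sqr, lam_gt2); rewrite ltNge; apply/negP => l1.
by have : lam' ^+ 2 * 1 < lam' ^+ 2 * lam ^+ 2; [rewrite ltr_pM2l //; lra|nra].
Qed.

Local Notation aut := (heis_aut A B C D na nb).
(** The square of the automorphism multiplies the time of the flow by lam ^ 2,
    which is positive even if lam is negative, contracts the direction
    (al', be') by lam' ^ 2, and acts trivially on the centre. *)
Let nS (p : nilm R) : nilm R := nilm_aut A B C D na nb (nilm_aut A B C D na nb p).
(** The slide that brings the image of the plane x + y = 0 back to that plane:
    (x, -x) is mapped to lam' ^ 2 (x, -x) - kappa x (al, be). *)
Let kappa : R := (lam ^+ 2 - lam' ^+ 2) * shear.
Let q (x : R) : R :=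
  hz (flow_elt al be ga (kappa * x) * aut (aut (Heis x (- x) 0)))%g.

Let mq : measurable_fun setT q.
Proof.
have mx : measurable_fun setT (fun x : R => x) by [].
have mN : measurable_fun setT (fun x : R => - x) by measurable_poly.
have m0 : measurable_fun setT (fun _ : R => 0 : R) by [].
have [m1 m2 m3] := measurable_heis_aut A B C D na nb mx mN m0.
have [_ m5 m6] := measurable_heis_aut A B C D na nb m1 m2 m3.
apply: measurable_funD; first by apply: measurable_funD m6; measurable_poly.
by apply: measurable_funM m5; measurable_poly.
Qed.

Let nS_inj : injective nS.
Proof. by move=> p p' /(nilm_aut_inj det_unit) /(nilm_aut_inj det_unit). Qed.

Let nS_flow t p : nS (Phi t p) = Phi (lam ^+ 2 * t) (nS p).
Proof. by rewrite /nS !(nilm_aut_flow _ _ lam_x lam_y lam_ga) mulrA. Qed.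

(** For u = al and u = - be this is the positivity required of a transfer; it
    follows from the one for [Sigma], as lam ^ 2 > lam' ^ 2 > 0. *)
Let step (u : R) : 0 < 1 + shear * u -> 0 < lam ^+ 2 + kappa * u.
Proof.
move=> u0; rewrite (_ : _ + _ = (lam ^+ 2 - lam' ^+ 2) * (1 + shear * u) + lam' ^+ 2).
  by rewrite ltr_wpDl // mulr_ge0 ?(ltW u0) // subr_ge0 ltW.
by rewrite /kappa; ring.
Qed.

Let al1 : 0 < lam ^+ 2 + kappa * al.
Proof. by apply: step; rewrite shear_al divr_gt0 // covol_gt0. Qed.
Let be1 : 0 < lam ^+ 2 - kappa * be.
Proof.
rewrite -mulrN; apply: step; rewrite mulrN shear_be divr_gt0 ?oppr_gt0 //.
exact: covol_gt0.
Qed.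

Let nS_param (x z : R) : Phi (kappa * x) (nS (nilD_param x z)) =
  nproj (Heis (lam' ^+ 2 * x) (- lam' ^+ 2 * x) (z + q x)).
Proof.
rewrite /nS /nilD_param !nilm_autE flow_nproj (heis_aut2_vertical _ _ det_unit).
(* (1, -1) in the basis of the eigenvectors *)
have one1 : 1 = (al' - (al' + be') * al) / covol.
  apply: (mulIf c0); rewrite divfK // mul1r /covol.
  have -> : be = 1 - al by rewrite -al_be; ring.
  by ring.
have one2 : -1 = (be' - (al' + be') * be) / covol.
  apply: (mulIf c0); rewrite divfK // mulN1r /covol.
  have -> : al = 1 - be by rewrite -al_be; ring.
  by ring.
have comb (a b : R) : a - b =
    ((a * al' + b * be') - (al' + be') * (a * al + b * be)) / covol.
  transitivity (a * ((al' - (al' + be') * al) / covol) +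
                b * ((be' - (al' + be') * be) / covol)); last by ring.
  by rewrite -one1 -one2; ring.
have AB := comb A%:~R B%:~R; rewrite lam'_x lam_x in AB.
have CD := comb C%:~R D%:~R; rewrite lam'_y lam_y in CD.
set g := aut (aut _).
have gx : hx g = (A%:~R * (A%:~R - B%:~R) + B%:~R * (C%:~R - D%:~R)) * x.
  by rewrite /g /=; ring.
have gy : hy g = (C%:~R * (A%:~R - B%:~R) + D%:~R * (C%:~R - D%:~R)) * x.
  by rewrite /g /=; ring.
have sqr_x : A%:~R * (A%:~R - B%:~R) + B%:~R * (C%:~R - D%:~R) = lam' ^+ 2 - kappa * al.
  rewrite AB CD /kappa /shear.
  transitivity ((lam' * (A%:~R * al' + B%:~R * be') -
    (al' + be') * (lam * (A%:~R * al + B%:~R * be))) / covol); first by ring.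
  rewrite lam'_x lam_x; transitivity (lam' ^+ 2 * ((al' - (al' + be') * al) / covol) -
    (lam ^+ 2 - lam' ^+ 2) * ((al' + be') / covol) * al); first by ring.
  by rewrite -one1 mulr1.
have sqr_y : C%:~R * (A%:~R - B%:~R) + D%:~R * (C%:~R - D%:~R) = - lam' ^+ 2 - kappa * be.
  rewrite AB CD /kappa /shear.
  transitivity ((lam' * (C%:~R * al' + D%:~R * be') -
    (al' + be') * (lam * (C%:~R * al + D%:~R * be))) / covol); first by ring.
  rewrite lam'_y lam_y; transitivity (lam' ^+ 2 * ((be' - (al' + be') * be) / covol) -
    (lam ^+ 2 - lam' ^+ 2) * ((al' + be') / covol) * be); first by ring.
  by rewrite -one2 mulrN1.
rewrite sqr_x in gx; rewrite sqr_y in gy.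
rewrite /q -/g; case: g gx gy => X Y Z /= -> ->.
by congr nproj; congr Heis => /=; ring.
Qed.

Local Notation r := (lam' ^+ 2).
Local Notation G := (transfer al be ga nS kappa).

Let in_box (x : R) : - be <= x < al -> - be <= r * x < al.
Proof.
move=> /andP[x0 x1]; have [r0 r1] := (lam'_gt0, lam'_lt1).
have [a0 b0] := (al_ge0, be_ge0).
apply/andP; split; first by nra.
have [x2|x2] := leP 0 x; first by nra.
by apply: lt_le_trans a0; rewrite pmulr_rlt0.
Qed.

Let transferE (x z : R) : - be <= x < al ->
  G (nilD_param x z) = nilD_param (r * x) (z + q x).
Proof. by move=> xI; rewrite (transfer_param al_be nS_param) // mulNr. Qed.

Let image_nilD : G @` nilD R `<=` nilD R.
Proof.
move=> _ [p /(nilD_paramP al_be)[x [z [xI ->]]] <-].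
by rewrite transferE //; exact: nilD_nilD_param.
Qed.

Let measurable_image (E : set (nilm R)) : measurable E ->
  measurable (G @` (nilD R `&` E)).
Proof.
apply: (measurable_transfer_image al_be al_ge0 be_ge0 nS_inj nS_flow _ lam'_gt0 mq
  al1 be1 nS_param).
exact: lt_trans lam_gt2.
Qed.

(** The image of D is the part of D over lam' ^ 2 [-be, al), with the fibres of E
    transported isometrically. *)
Let mu_image (E : set (nilm R)) : measurable E ->
  mu (G @` (nilD R `&` E)) = (r%:E * mu E)%E.
Proof.
move=> mE; have mG := measurable_image mE.
rewrite !haar_nilDE_box //; set F := nilD_fiber _.
have [[r0 r1] [a0 b0]] := ((lam'_gt0, lam'_lt1), (al_ge0, be_ge0)).
have mF : measurable_fun setT F by exact: measurable_nilD_fiber.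
have F0 x : (0 <= F x)%E by exact: fiber_measure_ge0.
have out (x : R) : - be <= x < al -> ~ (r * (- be) <= x < r * al) -> F x = 0%E.
  move=> xI nx; rewrite /F /nilD_fiber /fiber_measure.
  rewrite (_ : [set z | _] = set0) ?measure0 //.
  apply/seteqP; split=> z //= [_ [_ [/(nilD_paramP al_be)[x' [z' [x'I ->]]] _]]].
  rewrite transferE // => /(nilD_param_inj al_be (in_box x'I) xI) xE.
  by apply: nx; rewrite -xE ler_pM2l // ltr_pM2l.
have -> : (\int[leb]_(x in `[(- be)%R, al[) F x)%E =
    (\int[leb]_(x in `[(r * - be)%R, (r * al)%R[) F x)%E.
  have h1 : - be <= r * - be by nra.
  have h2 : r * - be <= r * al by nra.
  have h3 : r * al <= al by nra.
  rewrite (@ge0_integral_itv_split _ _ (r * - be)) //; last by rewrite h1 (le_trans h2).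
  rewrite (@ge0_integral_itv_split _ (r * - be) (r * al) al) ?h2 //.
  rewrite integral0_eq ?add0e; last first.
    move=> x; rewrite /= in_itv /= => /andP[x0 x1]; apply: out.
      by rewrite x0 (lt_le_trans x1) // (le_trans h2).
    by move=> /andP[]; rewrite leNgt x1.
  rewrite [X in (_ + X)%E]integral0_eq ?adde0 // => x.
  rewrite /= in_itv /= => /andP[x0 x1]; apply: out.
    by rewrite x1 (le_trans h1) // (le_trans h2).
  by move=> /andP[_]; rewrite ltNge x0.
rewrite (@ge0_integral_scale _ r) //; congr (_ * _)%E.
apply: eq_integral => x; rewrite inE /= in_itv /= => xI.
rewrite -(transfer_fiber al_be al_ge0 be_ge0 nS_inj nS_flow _ al1 be1 nS_param 0) //.
  rewrite /F /nilD_fiber -(fiber_measureE _ _ 0 0) // mulNr; congr leb.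
  by apply/seteqP; split=> z /=; rewrite addr0.
exact: lt_trans lam_gt2.
Qed.

Lemma niltranslation_mp_system : is_mp_system mu (nilD R) T.
Proof.
have mT : measurable_fun setT T.
  move=> _ E mE; rewrite setTI; apply/nilm_measurableP.
  rewrite -[X in measurable X]setTI.
  rewrite (_ : _ @^-1` _ = (fun w : R * R * R => nproj (Heis (al + w.1.1) (be + w.1.2)
      (ga + al * be / 2 + w.2 + al * w.1.2))) @^-1` E).
    suff mf : measurable_fun setT (fun w : R * R * R => nproj (Heis (al + w.1.1)
      (be + w.1.2) (ga + al * be / 2 + w.2 + al * w.1.2))) by exact: mf.
    by apply: measurable_nproj; measurable_poly.
  by apply/seteqP; split=> w; rewrite /coord_nproj /preimage /= /niltranslation nactE.
split.
- exact: measurable_nilD.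
- by rewrite mu_haar.1 lte01 ltry.
- by move=> p; exact: nilD_niltranslation.
- exact: measurable_funTS.
- move=> E mE; rewrite !haar_nilD_setI //; last first.
    by rewrite -[X in measurable X]setTI; exact: mT.
  by apply: mu_haar.2 => //; rewrite /surfD /= al_be.
Qed.

(** The inducing set is the image of D under the transfer by the squared
    automorphism, of measure lam' ^ 2. *)
Theorem niltranslation_self_induced : self_induced mu (nilD R) T.
Proof.
split; first exact: niltranslation_mp_system.
have l0 : 0 < lam ^+ 2 by exact: lt_trans lam_gt2.
have muG : mu (G @` nilD R) = r%:E.
  by rewrite -[nilD R]setIT mu_image // probability_setT mule1.
exists (G @` nilD R); split.
- by rewrite -[nilD R]setIT; exact: measurable_image.
- exact: image_nilD.
- by rewrite muG mu_haar.1 !lte_fin lam'_gt0 lam'_lt1.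
apply: (transfer_conjugate al_be al_ge0 be_ge0 nS_inj nS_flow l0 lam'_gt0 mq al1 be1
  nS_param).
- exact: measure0.
- exact: measure0.
- move=> p Dp; have rt := transfer_return_time al_be al_ge0 be_ge0 nS_inj nS_flow
    l0 al1 be1 Dp.
  rewrite (induced_mapE al_be image_nilD _ rt); last by exists p.
  exact: transfer_niltranslation.
- by apply: normalized_scale lam'_gt0 _; exact: mu_image.
Qed.

End SelfInduced.
End Sections.

(** * The niltranslation, the return map to Sigma and the self-induction *)

Theorem proposition8 (R : realType)
  (sigma : {multiplicative F2 -> F2}) (sigma_bij : bijective sigma)
  (frS : {multiplicative Gamma -> Gamma}) (frS_bij : bijective frS)
  (frS_sigma : forall w : F2, frS (F2_Gamma w) = F2_Gamma (sigma w))
  (M : 'M[int]_2)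
  (M_action : forall g : Gamma, heis_xy (frS g) = M *m heis_xy g)
  (lam lam' : R)
  (lam_eigen : eigenvalue (map_mx intr M : 'M[R]_2) lam)
  (lam'_eigen : eigenvalue (map_mx intr M : 'M[R]_2) lam')
  (lam_lam' : `|lam * lam'| = 1) (lam_gt : `|lam'| < `|lam|)
  (al be : R) (al_ge0 : 0 <= al) (be_ge0 : 0 <= be) (al_be : al + be = 1)
  (al_be_eigen : map_mx intr M *m vec2 al be = lam *: vec2 al be)
  (al' be' : R) (al'_be' : al' ^+ 2 + be' ^+ 2 = 1)
  (al'_gt0 : 0 < al') (be'_lt0 : be' < 0)
  (al'_be'_eigen : map_mx intr M *m vec2 al' be' = lam' *: vec2 al' be')
  (ga ga' : R)
  (gaE : ga = gamma_coord M (hz (frS n_a)) (hz (frS n_b)) al be lam)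
  (ga'E : ga' = gamma_coord M (hz (frS n_a)) (hz (frS n_b)) al' be' lam')
  (Delta t_a t_b d_a d_b : R)
  (DeltaE : Delta = al * be' - al' * be)
  (t_aE : t_a = be' / Delta) (t_bE : t_b = - al' / Delta)
  (d_aE : d_a = Num.sqrt ((t_a * al - 1) ^+ 2 + (t_a * be) ^+ 2))
  (d_bE : d_b = Num.sqrt ((t_b * al) ^+ 2 + (t_b * be - 1) ^+ 2))
  (Q : R -> R -> R)
  (Q_graph : forall x y z : R,
     orbit_surface al be ga al' be' ga' (Heis x y z) <-> z = Q x y)
  (mu : probability (nilm R) R) (mu_haar : is_haar_nilD mu) :
  let Phi := flow al be ga in
  let T_sigma := niltranslation al be ga in
  let Sig := Sigma al' be' d_a d_b Q in
  let T_Sig := return_map Phi Sig in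
  [/\ is_section Phi (nilD R),
      forall p, nilD R p -> is_return_time Phi (nilD R) p 1,
      forall p, nilD R p -> return_map Phi (nilD R) p = T_sigma p,
      (forall p, Sig p -> exists t, is_return_time Phi Sig p t) /\
      measurably_conjugate (Sigma_measure al' be' d_a d_b Q) Sig T_Sig
        mu (nilD R) T_sigma
    & self_induced mu (nilD R) T_sigma].
Proof.
move=> Phi T_sigma Sig T_Sig.
have [lam_x lam_y] := eigen_coords al_be_eigen.
have [lam'_x lam'_y] := eigen_coords al'_be'_eigen.
have c0 := covol_gt0 al_ge0 be_ge0 al_be al'_gt0 be'_lt0.
have DeltaE' : Delta = - covol al be al' be' by rewrite DeltaE /covol; ring.
have Delta0 : Delta < 0 by rewrite DeltaE' oppr_lt0.
have d_aE' : d_a = be / covol al be al' be'.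
  rewrite d_aE t_aE -[covol _ _ _ _]opprK -DeltaE'; apply: sqrt_sqr_quotient => //.
  transitivity ((al' ^+ 2 + be' ^+ 2) * (be / Delta) ^+ 2).
    by rewrite DeltaE; field; rewrite -DeltaE lt_eqF.
  by rewrite al'_be' mul1r.
have d_bE' : d_b = al / covol al be al' be'.
  rewrite d_bE t_bE -[covol _ _ _ _]opprK -DeltaE'; apply: sqrt_sqr_quotient => //.
  transitivity ((al' ^+ 2 + be' ^+ 2) * (al / Delta) ^+ 2).
    by rewrite DeltaE; field; rewrite -DeltaE lt_eqF.
  by rewrite al'_be' mul1r.
split.
- split; first exact: measurable_nilD.
  by move=> p; exact: nilD_return_exists.
- by move=> p; exact: nilD_return_time.
- move=> p Dp; rewrite (return_mapE (nilD_return_time ga al_be Dp)).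
  by rewrite -niltranslationE.
- split; first by move=> p; exact: Sigma_returns.
  exact: Sigma_conjugate.
have detE : \det M = M 0 0 * M 1 1 - M 0 1 * M 1 0.
  rewrite (expand_det_row _ 0) !big_ord_recl big_ord0 /cofactor !det_mx11 !mxE /=.
  have -> : lift ord0 ord0 = 1 :> 'I_2 by exact: val_inj.
  have -> : lift 1 0 = 0 :> 'I_2 by exact: val_inj.
  by rewrite expr0 mul1r expr1 mulN1r addr0 mulrN.
have det_lamE := det_lam al_ge0 be_ge0 al_be al'_gt0 be'_lt0 lam_x lam_y lam'_x lam'_y.
apply: (niltranslation_self_induced al_ge0 be_ge0 al_be al'_gt0 be'_lt0 mu_haar
  lam_x lam_y lam'_x lam'_y (_ : _ = ga * _) lam_lam' lam_gt).
have clear_denom (X Y u : R) : u != 0 ->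
    al * X + be * Y = (al / u * X + be / u * Y) * u by move=> ?; field.
rewrite gaE /gamma_coord detE; apply: clear_denom.
(* lam = lam * lam' would force lam' = 1 = |lam|. *)
rewrite det_lamE; apply/eqP => e.
have /eqP : lam * (1 - lam') = 0 by rewrite -[RHS]e; ring.
rewrite mulf_eq0 subr_eq0 => /orP[/eqP l0|/eqP l1].
  by move: lam_gt; rewrite l0 normr0 ltNge normr_ge0.
by move: lam_lam' lam_gt; rewrite -l1 mulr1 => ->; rewrite normr1 ltxx.
Qed.
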